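(* Let $\alpha=a+\tfrac12$, $t_0=\tfrac12\left(z+\sqrt{z^2+4\alpha}\right)$ and $f(w)=w+i\log(1+iw)$. For $\Re(z)>0$ the following holds for any $a\in\mathbb{C}$: $$U(a,z)=\frac{1}{\sqrt{2\pi}}\,e^{-\frac14 z\sqrt{z^2+4\alpha}}\,e^{\alpha/2}\,t_0^{-\alpha}\int_{-\infty}^{+\infty}e^{-\frac12 s^2+i\alpha f(s/t_0)}\,ds .$$ For real positive $\alpha$ the result holds in $\mathbb{C}\setminus\{z:\Re(z)=0,\ |\Im(z)|>2\sqrt{\alpha}\}$.
   Context: $U(a,z)$ denotes the parabolic cylinder function: the solution, entire in $z$, of $\frac{d^2y}{dz^2}-\left(\frac14 z^2+a\right)y=0$ which is uniquely determined by the behaviour $U(a,z)\sim z^{-a-\frac12}e^{-\frac14 z^2}$ as $z\to\infty$ with $|\arg(z)|\le\frac34\pi-\delta$ (for $\delta>0$). It has the integral representation $U(a,z)=\frac{e^{z^2/4}}{i\sqrt{2\pi}}\int_{c-i\infty}^{c+i\infty}e^{\phi(t)}\,dt$ for $c>0$, $|\arg(t)|<\frac12\pi$, where $\phi(t)=\frac12t^2-zt-\alpha\log t$. The point $t_0$ is a saddle point of $\phi$, that is, a solution of $\phi'(t)=0$, and the integral in the claim corresponds to the vertical integration path $t=t_0+is$, $s\in(-\infty,+\infty)$. Square roots, logarithms and powers take their principal values.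
   Formalization: For real positive α the formal statement also excludes the end points z = ±2i√α: there the path meets the branch point, the integral diverges for α ≥ 1, and for 0 < α < 1 the identity with principal logarithms fails at z = 2i√α. *)

(* Defs.v *)
From Stdlib Require Import Reals.
From Coquelicot Require Import Coquelicot.
Open Scope R_scope.
Open Scope C_scope.

Definition Cexp (z : C) : C :=
  (exp (Re z) * cos (Im z), exp (Re z) * sin (Im z))%R.

(* Principal argument, with values in (-PI, PI] for z <> 0; negative reals have
   argument PI. *)
Definition Carg (z : C) : R :=
  if Rle_dec 0 (Im z) then acos (Re z / Cmod z) else (- acos (Re z / Cmod z))%R.

Definition Clog (z : C) : C := (ln (Cmod z), Carg z).

(* Meaningful for z <> 0 only; Coquelicot's Cpow has exponents in nat. *)
Definition Cpower (z w : C) : C := Cexp (w * Clog z).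

(* In polar form, so that Csqrt 0 = 0. *)
Definition Csqrt (z : C) : C := sqrt (Cmod z) * Cexp (Ci * (Carg z / 2)).

Definition is_Cderive (g : C -> C) (z l : C) : Prop :=
  @is_derive C_AbsRing C_NormedModule g z l.

(* g ~ h as z -> oo, uniformly in the closed sector |arg z| <= theta. *)
Definition equiv_in_sector (theta : R) (g h : C -> C) : Prop :=
  forall eps : R, (0 < eps)%R ->
  exists M : R, forall z : C,
    (M < Cmod z)%R -> (Rabs (Carg z) <= theta)%R ->
    (Cmod (g z / h z - 1) < eps)%R.

(* U is the parabolic cylinder function z |-> U(a, z). *)
Record is_parabolic_cylinder_U (a : C) (U : C -> C) : Prop := {
  pcU_ode : exists U' U'' : C -> C, forall z : C,
    is_Cderive U z (U' z) /\ is_Cderive U' z (U'' z) /\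
    U'' z - (z ^ 2 / 4 + a) * U z = 0;
  pcU_asymptotic : forall delta : R, (0 < delta)%R ->
    equiv_in_sector (3 / 4 * PI - delta) U
      (fun z => Cpower z (- a - 1 / 2) * Cexp (- (z ^ 2 / 4)))
}.

Definition saddle_point (alpha z : C) : C :=
  (z + Csqrt (z ^ 2 + 4 * alpha)) / 2.

Definition saddle_f (w : C) : C := w + Ci * Clog (1 + Ci * w).

(* The cuts of sqrt (z^2 + 4 alpha), alpha > 0, with their end points
   z = +-2 i sqrt alpha. At the end points the saddle point is +-i sqrt alpha,
   so the path saddle_point + i s runs along the imaginary axis, through the
   branch point 0 of t^(-alpha), where the integrand behaves like
   |t|^(-alpha). *)
Definition on_cut (alpha : R) (z : C) : Prop :=
  Re z = 0%R /\ (2 * sqrt alpha <= Rabs (Im z))%R.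

(* Main.v *)
Require Import Defs.
From Stdlib Require Import Reals Lra Psatz.
From Coquelicot Require Import Coquelicot.
Open Scope R_scope.
Open Scope C_scope.

(** Write alpha = a + 1/2 and, for Re p > 0,

      I(alpha, z, p) = int_R exp (t^2/2 - z t - alpha log t) ds,    t = p + i s.

    The claim is the classical contour representation
    U(a, z) = exp (z^2/4) I(alpha, z, p) / sqrt (2 pi), taken along the vertical
    line through the saddle point: for p = t0 the equation t0^2 - z t0 = alpha
    turns the terms i s (t0 - z) of the exponent into i alpha s/t0, the linear
    term of i alpha f(s/t0), and the exponent becomes -s^2/2 + i alpha f(s/t0)
    plus its value at t0, which gives the factors in front of the integral. This needs Re t0 > 0
    ([Re_saddle_point_pos]), which is where the two alternatives of the
    hypothesis enter; the line then stays in the right half-plane, where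
    log (1 + i s/t0) = log (t0 + i s) - log t0 holds for principal values.

    Multiplying the integrand by t lowers alpha by one, so all derivatives of the
    integrand in z and t are combinations of integrands with shifted alpha, and
    all of them are bounded by a constant times 1 / (1 + s^2), locally uniformly
    in z and p. A second-order Taylor bound under the integral therefore gives
    every differentiation that is needed. In z: dI(alpha)/dz = - I(alpha - 1). In
    p: the derivative of I is the integral of a derivative, hence 0, so I does
    not depend on p ([line_integral_path_independent]). The same vanishing
    integral is the three-term recurrence
    I(alpha - 1) - z I(alpha) - alpha I(alpha + 1) = 0, which is the parabolic
    cylinder equation for exp (z^2/4) I(alpha, z, p) ([pcU_integral_solution]).
    For real z = x > 0 the choice p = x turns I into
    exp (-x^2/2) int_R exp (-s^2/2) (x + i s)^(-alpha) ds, whose leading term as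
    x -> +oo is sqrt (2 pi) exp (-x^2/2) x^(-alpha)
    ([line_integral_asymptotic]).

    It remains to see that a solution of the equation is determined by its
    recessive behaviour along the positive real axis ([recessive_unique]). Such a
    solution decays exponentially together with its derivative, the latter
    because the equation bounds the second derivative, so the Wronskian of two of
    them, a constant, is 0. They are then proportional, and the asymptotic
    behaviour fixes the factor. *)

(** * Complex numbers and the exponential *)

Lemma Ceq_parts (x y : C) : Re x = Re y -> Im x = Im y -> x = y.
Proof. destruct x, y; simpl; congruence. Qed.

Lemma Re_plus x y : Re (x + y) = (Re x + Re y)%R. Proof. reflexivity. Qed.
Lemma Im_plus x y : Im (x + y) = (Im x + Im y)%R. Proof. reflexivity. Qed.
Lemma Re_opp x : Re (- x) = (- Re x)%R. Proof. reflexivity. Qed.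
Lemma Im_opp x : Im (- x) = (- Im x)%R. Proof. reflexivity. Qed.
Lemma Re_minus x y : Re (x - y) = (Re x - Re y)%R. Proof. reflexivity. Qed.
Lemma Im_minus x y : Im (x - y) = (Im x - Im y)%R. Proof. reflexivity. Qed.
Lemma Re_mult x y : Re (x * y) = (Re x * Re y - Im x * Im y)%R.
Proof. reflexivity. Qed.
Lemma Im_mult x y : Im (x * y) = (Re x * Im y + Im x * Re y)%R.
Proof. reflexivity. Qed.
Lemma Re_Cexp x : Re (Cexp x) = (exp (Re x) * cos (Im x))%R.
Proof. reflexivity. Qed.
Lemma Im_Cexp x : Im (Cexp x) = (exp (Re x) * sin (Im x))%R.
Proof. reflexivity. Qed.
Lemma Re_R (x : R) : Re x = x. Proof. reflexivity. Qed.
Lemma Im_R (x : R) : Im x = 0%R. Proof. reflexivity. Qed.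
Lemma Re_Ci : Re Ci = 0%R. Proof. reflexivity. Qed.
Lemma Im_Ci : Im Ci = 1%R. Proof. reflexivity. Qed.

Ltac parts := rewrite ?Re_minus, ?Im_minus, ?Re_plus, ?Im_plus, ?Re_opp, ?Im_opp,
  ?Re_mult, ?Im_mult, ?Re_Cexp, ?Im_Cexp, ?Re_R, ?Im_R, ?Re_Ci, ?Im_Ci.
Ltac partsr := repeat (progress parts).

Lemma Cmod_sqr (x : C) : (Cmod x * Cmod x = Re x * Re x + Im x * Im x)%R.
Proof. generalize (Cmod2_alt x); simpl; lra. Qed.

Lemma im_le_Cmod (c : C) : (Rabs (Im c) <= Cmod c)%R.
Proof.
  apply Rle_trans with (2 := Rmax_Cmod c). apply Rmax_r.
Qed.

Lemma Cmod_le_parts (x : C) : (Cmod x <= Rabs (Re x) + Rabs (Im x))%R.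
Proof.
  apply Rsqr_incr_0_var.
  - unfold Rsqr. rewrite Cmod_sqr.
    rewrite <- (Rabs_right (Re x * Re x)), <- (Rabs_right (Im x * Im x)), !Rabs_mult by nra.
    generalize (Rabs_pos (Re x)) (Rabs_pos (Im x)); nra.
  - generalize (Rabs_pos (Re x)) (Rabs_pos (Im x)); lra.
Qed.

Lemma Cmod_triang_minus (x y : C) : (Cmod (x - y) <= Cmod x + Cmod y)%R.
Proof. unfold Cminus. rewrite <- (Cmod_opp y). apply Cmod_triangle. Qed.

Lemma RtoC_neq_0 (x : R) : x <> 0%R -> RtoC x <> 0.
Proof. intros H E. apply H. now apply RtoC_inj. Qed.

Lemma Re_half (z : C) : Re (z / 2) = (Re z / 2)%R.
Proof. unfold Cdiv. rewrite <- (RtoC_inv 2) by lra. partsr. field. Qed.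

Lemma Re_div4 (z : C) : Re (z / 4) = (Re z / 4)%R.
Proof. unfold Cdiv. rewrite <- (RtoC_inv 4) by lra. partsr. field. Qed.

Lemma Re_prod_le x y : (Rabs (Re (x * y)) <= Cmod x * Cmod y)%R.
Proof. rewrite <- Cmod_mult. apply re_le_Cmod. Qed.

Lemma Cexp_plus x y : Cexp (x + y) = Cexp x * Cexp y.
Proof.
  apply Ceq_parts; partsr; rewrite exp_plus, ?cos_plus, ?sin_plus; ring.
Qed.

Lemma Cexp_R (x : R) : Cexp x = exp x.
Proof. apply Ceq_parts; partsr; rewrite ?cos_0, ?sin_0; ring. Qed.

Lemma Cexp_0 : Cexp 0 = 1.
Proof. rewrite Cexp_R, exp_0. reflexivity. Qed.

Lemma Cmod_Cexp x : Cmod (Cexp x) = exp (Re x).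
Proof.
  unfold Cmod, Cexp; simpl.
  replace (_ + _)%R with (Rsqr (exp (Re x)) * (Rsqr (sin (Im x)) + Rsqr (cos (Im x))))%R
    by (unfold Rsqr; ring).
  rewrite sin2_cos2, Rmult_1_r. apply sqrt_Rsqr. left; apply exp_pos.
Qed.

Lemma Cexp_neq_0 x : Cexp x <> 0.
Proof. apply Cmod_gt_0. rewrite Cmod_Cexp. apply exp_pos. Qed.

Lemma Cexp_opp x : Cexp (- x) = / Cexp x.
Proof.
  assert (H := Cexp_neq_0 x).
  assert (E : Cexp x * Cexp (- x) = 1)
   by (rewrite <- Cexp_plus, <- Cexp_0; f_equal; ring).
  replace (Cexp (-x)) with (/ Cexp x * (Cexp x * Cexp (-x))) by (now field).
  rewrite E; ring.
Qed.

(** * Derivatives of paths in the complex plane *)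

(** Complex derivatives only ever occur along real one-parameter paths, and in
    components they reduce to real calculus. *)
Definition path_derive (f : R -> C) (x : R) (l : C) : Prop :=
  is_derive (fun s => Re (f s)) x (Re l) /\ is_derive (fun s => Im (f s)) x (Im l).

Lemma path_derive_eq f x l l' : path_derive f x l -> l = l' -> path_derive f x l'.
Proof. intros H <-; exact H. Qed.

Lemma path_derive_const c x : path_derive (fun _ => c) x 0.
Proof.
  split.
  - change (is_derive (fun _ : R => Re c) x 0%R). auto_derive; trivial.
  - change (is_derive (fun _ : R => Im c) x 0%R). auto_derive; trivial.
Qed.

Lemma path_derive_id x : path_derive (fun s => RtoC s) x 1.
Proof.
  split.
  - change (is_derive (fun s : R => s) x 1%R). auto_derive; trivial.
  - change (is_derive (fun _ : R => 0%R) x 0%R). auto_derive; trivial.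
Qed.

Lemma path_derive_plus f g x l m : path_derive f x l -> path_derive g x m ->
  path_derive (fun s => f s + g s) x (l + m).
Proof. intros [H1 H2] [H3 H4]; split;
  apply (is_derive_plus (K:=R_AbsRing) (V:=R_NormedModule)); assumption. Qed.

Lemma path_derive_opp f x l : path_derive f x l -> path_derive (fun s => - f s) x (- l).
Proof. intros [H1 H2]; split; apply (is_derive_opp (K:=R_AbsRing) (V:=R_NormedModule));
  assumption. Qed.

Lemma path_derive_minus f g x l m : path_derive f x l -> path_derive g x m ->
  path_derive (fun s => f s - g s) x (l - m).
Proof. intros [H1 H2] [H3 H4]; split;
  apply (is_derive_minus (K:=R_AbsRing) (V:=R_NormedModule)); assumption. Qed.

Lemma path_derive_mult f g x l m : path_derive f x l -> path_derive g x m ->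
  path_derive (fun s => f s * g s) x (l * g x + f x * m).
Proof.
  intros [H1 H2] [H3 H4]; split.
  - apply is_derive_ext with (fun s => Re (f s) * Re (g s) - Im (f s) * Im (g s))%R.
    reflexivity.
    replace (Re _) with ((Re l * Re (g x) + Re (f x) * Re m) -
       (Im l * Im (g x) + Im (f x) * Im m))%R by (partsr; ring).
    apply (is_derive_minus (K:=R_AbsRing) (V:=R_NormedModule));
      apply (is_derive_mult (K:=R_AbsRing)); try assumption; intros; apply Rmult_comm.
  - apply is_derive_ext with (fun s => Re (f s) * Im (g s) + Im (f s) * Re (g s))%R.
    reflexivity.
    replace (Im _) with ((Re l * Im (g x) + Re (f x) * Im m) +
       (Im l * Re (g x) + Im (f x) * Re m))%R by (partsr; ring).
    apply (is_derive_plus (K:=R_AbsRing) (V:=R_NormedModule));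
      apply (is_derive_mult (K:=R_AbsRing)); try assumption; intros; apply Rmult_comm.
Qed.

Lemma path_derive_scal c f x l : path_derive f x l ->
  path_derive (fun s => c * f s) x (c * l).
Proof.
  intros H. eapply path_derive_eq. apply path_derive_mult. apply path_derive_const.
  apply H. cbv beta; ring.
Qed.

Lemma path_derive_Cexp f x l : path_derive f x l ->
  path_derive (fun s => Cexp (f s)) x (l * Cexp (f x)).
Proof.
  intros [H1 H2].
  assert (G : forall (u v : R -> R) (u' v' : R), is_derive u x u' -> is_derive v x v' ->
    is_derive (fun s => exp (u s) * cos (v s))%R x
      (u' * (exp (u x) * cos (v x)) - v' * (exp (u x) * sin (v x)))%R /\
    is_derive (fun s => exp (u s) * sin (v s))%R x
      (u' * (exp (u x) * sin (v x)) + v' * (exp (u x) * cos (v x)))%R);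
  [|exact (G _ _ _ _ H1 H2)].
  intros u v u' v' Hu Hv; split.
  - auto_derive.
    + repeat split; eexists; eassumption.
    + rewrite (is_derive_unique (fun s : R => u s) _ _ Hu),
      (is_derive_unique (fun s : R => v s) _ _ Hv). ring.
  - auto_derive.
    + repeat split; eexists; eassumption.
    + rewrite (is_derive_unique (fun s : R => u s) _ _ Hu),
      (is_derive_unique (fun s : R => v s) _ _ Hv). ring.
Qed.

Lemma path_derive_line p d x : path_derive (fun s : R => p + s * d) x d.
Proof.
  eapply path_derive_eq. apply path_derive_plus. apply path_derive_const.
  apply path_derive_mult. apply path_derive_id. apply path_derive_const. cbv beta; ring.
Qed.

Lemma path_derive_of_little_o f x l :
  (forall e : R, 0 < e -> exists d : R, 0 < d /\ forall h : R, Rabs h < d ->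
    Cmod (f (x + h)%R - f x - h * l) <= e * Rabs h)%R ->
  path_derive f x l.
Proof.
  intros H.
  assert (G : forall (g : R -> R) (m : R),
    (forall h : R, Rabs (g (x + h) - g x - h * m) <= Cmod (f (x + h)%R - f x - h * l))%R ->
    is_derive g x m).
  { intros g m Hg. apply is_derive_Reals. intros e He.
    destruct (H (e / 2)%R ltac:(lra)) as [d [Hd Hf]].
    exists (mkposreal _ Hd). intros h Hh0 Hh.
    assert (Hp : (0 < Rabs h)%R) by now apply Rabs_pos_lt.
    replace ((g (x + h) - g x) / h - m)%R with ((g (x + h) - g x - h * m) / h)%R
      by (field; trivial).
    unfold Rdiv. rewrite Rabs_mult, Rabs_inv.
    apply Rmult_lt_reg_r with (Rabs h); trivial.
    rewrite Rmult_assoc, Rinv_l, Rmult_1_r by lra.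
    generalize (Hg h) (Hf h Hh). nra. }
  split; apply G; intros h.
  - apply Rle_trans with (2 := re_le_Cmod _). right. f_equal. partsr. ring.
  - apply Rle_trans with (2 := im_le_Cmod _). right. f_equal. partsr. ring.
Qed.

Lemma path_derive_of_quadratic f x l B r : (0 < r)%R ->
  (forall h : R, Rabs h <= r -> Cmod (f (x + h)%R - f x - h * l) <= B * h ^ 2)%R ->
  path_derive f x l.
Proof.
  intros Hr H. apply path_derive_of_little_o. intros e He.
  assert (HB : (0 <= Rabs B)%R) by apply Rabs_pos.
  assert (Hq : (0 < e / (Rabs B + 1))%R) by (apply Rdiv_lt_0_compat; lra).
  exists (Rmin r (e / (Rabs B + 1))). split. now apply Rmin_pos.
  intros h Hh.
  assert (Hh1 : (Rabs h <= r)%R) by (left; apply Rlt_le_trans with (1 := Hh); apply Rmin_l).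
  assert (Hh2 : (Rabs h < e / (Rabs B + 1))%R) by (apply Rlt_le_trans with (1 := Hh);
    apply Rmin_r).
  apply Rle_trans with (1 := H h Hh1). rewrite <- pow2_abs.
  assert (Ee : e = ((Rabs B + 1) * (e / (Rabs B + 1)))%R) by (field; lra).
  assert (Hp := Rabs_pos h). assert (HBa := Rle_abs B).
  apply Rle_trans with ((Rabs B + 1) * Rabs h * Rabs h)%R.
  - nra.
  - apply Rmult_le_compat_r; trivial. rewrite Ee. apply Rmult_le_compat_l; lra.
Qed.

Lemma path_derive_of_is_Cderive g (z d l : C) (x : R) :
  is_Cderive g (z + x * d) l -> path_derive (fun s => g (z + s * d)) x (d * l).
Proof.
  intros [_ H]. apply path_derive_of_little_o. intros e He.
  assert (Hd := Cmod_ge_0 d).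
  assert (He' : (0 < e / (1 + Cmod d))%R) by (apply Rdiv_lt_0_compat; lra).
  destruct (H (z + x * d) (fun P HP => HP) (mkposreal _ He')) as [r Hr].
  exists (r / (1 + Cmod d))%R. split. apply Rdiv_lt_0_compat; [apply cond_pos|lra].
  intros h Hh.
  set (y := z + (x + h)%R * d).
  assert (Ey : y - (z + x * d) = h * d) by (unfold y; rewrite RtoC_plus; ring).
  assert (Hy : (Cmod (y - (z + x * d)) < r)%R).
  { rewrite Ey, Cmod_mult, Cmod_R.
    apply Rle_lt_trans with (Rabs h * (1 + Cmod d))%R.
    - apply Rmult_le_compat_l. apply Rabs_pos. lra.
    - apply Rmult_lt_reg_r with (/ (1 + Cmod d))%R. apply Rinv_0_lt_compat; lra.
      rewrite Rmult_assoc, Rinv_r, Rmult_1_r by lra. exact Hh. }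
  specialize (Hr y Hy).
  change (Rle (Cmod (g y - g (z + x * d) - (y - (z + x * d)) * l))
    (Rmult (e / (1 + Cmod d)) (Cmod (y - (z + x * d))))) in Hr.
  rewrite Ey in Hr. rewrite Cmult_assoc.
  apply Rle_trans with (1 := Hr). rewrite Cmod_mult, Cmod_R.
  apply Rmult_le_reg_r with (1 + Cmod d)%R. lra.
  replace (e / (1 + Cmod d) * (Rabs h * Cmod d) * (1 + Cmod d))%R with
    (e * Rabs h * Cmod d)%R
    by (field; lra).
  apply Rmult_le_compat_l. apply Rmult_le_pos. lra. apply Rabs_pos. lra.
Qed.

Lemma ex_derive_continuous_R (f : R -> R) (x : R) : ex_derive f x -> continuous f x.
Proof. exact (ex_derive_continuous (K:=R_AbsRing) (V:=R_NormedModule) f x). Qed.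

Lemma path_derive_continuous f x l : path_derive f x l ->
  @continuous _ C_R_NormedModule f x.
Proof.
  intros [H1 H2].
  assert (C1 : continuous (fun s => Re (f s)) x) by (apply ex_derive_continuous_R;
    now exists (Re l)).
  assert (C2 : continuous (fun s => Im (f s)) x) by (apply ex_derive_continuous_R;
    now exists (Im l)).
  intros P [e He].
  destruct (C1 (ball (Re (f x)) e)) as [d1 D1]. now exists e.
  destruct (C2 (ball (Im (f x)) e)) as [d2 D2]. now exists e.
  assert (Hd : (0 < Rmin d1 d2)%R) by (apply Rmin_pos; apply cond_pos).
  exists (mkposreal _ Hd). intros y Hy. apply He. split.
  - apply D1. eapply ball_le; [|exact Hy]; simpl; apply Rmin_l.
  - apply D2. eapply ball_le; [|exact Hy]; simpl; apply Rmin_r.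
Qed.

(** The mean value theorem fails for complex values but holds for both components,
    at the price of a factor 2. *)
Lemma mean_value_ineq (f f' : R -> C) (a b B : R) :
  (forall s, Rmin a b <= s <= Rmax a b -> path_derive f s (f' s))%R ->
  (forall s, Rmin a b <= s <= Rmax a b -> Cmod (f' s) <= B)%R ->
  (Cmod (f b - f a) <= 2 * B * Rabs (b - a))%R.
Proof.
  intros Hd HB.
  destruct (MVT_gen (fun s => Re (f s)) a b (fun s => Re (f' s))) as [c [Hc Ec]].
  { intros x Hx; apply (Hd x); lra. }
  { intros x Hx. apply continuity_pt_filterlim. apply ex_derive_continuous_R.
    exists (Re (f' x)). now apply Hd. }
  destruct (MVT_gen (fun s => Im (f s)) a b (fun s => Im (f' s))) as [d [Hd' Ed]].
  { intros x Hx; apply (Hd x); lra. }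
  { intros x Hx. apply continuity_pt_filterlim. apply ex_derive_continuous_R.
    exists (Im (f' x)). now apply Hd. }
  apply Rle_trans with (1 := Cmod_le_parts _).
  rewrite Re_minus, Im_minus, Ec, Ed, !Rabs_mult.
  assert (H1 := HB c Hc). assert (H2 := HB d Hd').
  assert (H3 := re_le_Cmod (f' c)). assert (H4 := im_le_Cmod (f' d)).
  assert (H5 := Rabs_pos (b - a)). nra.
Qed.

Lemma taylor_order2_ineq (f f' f'' : R -> C) (B : R) :
  (forall s, 0 <= s <= 1 -> path_derive f s (f' s))%R ->
  (forall s, 0 <= s <= 1 -> path_derive f' s (f'' s))%R ->
  (forall s, 0 <= s <= 1 -> Cmod (f'' s) <= B)%R ->
  (Cmod (f 1%R - f 0%R - f' 0%R) <= 4 * B)%R.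
Proof.
  intros H1 H2 HB.
  replace (f 1%R - f 0%R - f' 0%R) with
    ((f 1%R - RtoC 1 * f' 0%R) - (f 0%R - RtoC 0 * f' 0%R)) by ring.
  replace (4 * B)%R with (2 * (2 * B) * Rabs (1 - 0))%R
    by (rewrite Rabs_right; lra).
  assert (HB0 : (0 <= B)%R).
  { apply Rle_trans with (2 := HB 0%R ltac:(lra)). apply Cmod_ge_0. }
  apply (mean_value_ineq (fun s => f s - RtoC s * f' 0%R) (fun s => f' s - f' 0%R)).
  - rewrite Rmin_left, Rmax_right by lra. intros s Hs.
    eapply path_derive_eq. apply path_derive_minus. now apply H1. apply path_derive_mult.
    apply path_derive_id. apply path_derive_const.
    cbv beta; ring.
  - rewrite Rmin_left, Rmax_right by lra. intros s Hs.
    apply Rle_trans with (2 * B * Rabs (s - 0))%R.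
    2:{ rewrite Rabs_right by lra. nra. }
    apply mean_value_ineq with f''; rewrite Rmin_left, Rmax_right by lra; intros t Ht;
    [apply H2 | apply HB]; lra.
Qed.

Local Notation RInt_C := (RInt (V := C_R_CompleteNormedModule)).

(** * Improper integrals dominated by 1 / (1 + s^2) *)

Definition int_line (f : R -> C) (J : C) : Prop :=
  @is_RInt_gen C_R_NormedModule f (Rbar_locally m_infty) (Rbar_locally p_infty) J.

Definition path_differentiable (f : R -> C) : Prop := forall s, exists l, path_derive f s l.

(** The bound 1 / (1 + s^2) has the explicit primitive atan, which makes existence
    and estimates of the integrals elementary. *)
Definition dominated (f : R -> C) (B : R) : Prop :=
  forall s : R, (Cmod (f s) <= B / (1 + s ^ 2))%R.

(** Reduces the linear rules for complex integrals to those for real ones. *)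
Lemma int_line_parts f J :
  int_line f J <->
  is_RInt_gen (fun s => Re (f s)) (Rbar_locally m_infty) (Rbar_locally p_infty) (Re J) /\
  is_RInt_gen (fun s => Im (f s)) (Rbar_locally m_infty) (Rbar_locally p_infty) (Im J).
Proof.
  split.
  - intros H; split; intros P [e He].
    + destruct (H (fun z => ball (Re J) e (Re z))) as [Q S HQ HS HP].
      { exists e. now intros y [Hy _]. }
      exists Q S; trivial. intros x y Hx Hy.
      destruct (HP x y Hx Hy) as [z [Iz Bz]]. exists (Re z); split.
      * exact (is_RInt_fct_extend_fst _ _ _ _ Iz).
      * now apply He.
    + destruct (H (fun z => ball (Im J) e (Im z))) as [Q S HQ HS HP].
      { exists e. now intros y [_ Hy]. }
      exists Q S; trivial. intros x y Hx Hy.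
      destruct (HP x y Hx Hy) as [z [Iz Bz]]. exists (Im z); split.
      * exact (is_RInt_fct_extend_snd _ _ _ _ Iz).
      * now apply He.
  - intros [H1 H2] P [e He].
    destruct (H1 (ball (Re J) e)) as [Q S HQ HS HP]. now exists e.
    destruct (H2 (ball (Im J) e)) as [Q' S' HQ' HS' HP']. now exists e.
    exists (fun x => Q x /\ Q' x) (fun x => S x /\ S' x).
    + now apply (filter_and (F := Rbar_locally m_infty)).
    + now apply (filter_and (F := Rbar_locally p_infty)).
    + intros x y [Hx Hx'] [Hy Hy'].
      destruct (HP x y Hx Hy) as [u [Iu Bu]].
      destruct (HP' x y Hx' Hy') as [v [Iv Bv]].
      exists (u, v); split.
      * now apply (is_RInt_fct_extend_pair f).
      * now apply He.
Qed.

Lemma int_line_minus f g I J : int_line f I -> int_line g J ->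
  int_line (fun s => f s - g s) (I - J).
Proof.
  rewrite !int_line_parts; intros [H1 H2] [H3 H4]; split.
  - now apply (is_RInt_gen_minus (V :=
    R_NormedModule) (fun s => Re (f s)) (fun s => Re (g s))).
  - now apply (is_RInt_gen_minus (V :=
    R_NormedModule) (fun s => Im (f s)) (fun s => Im (g s))).
Qed.

Lemma int_line_scal c f J : int_line f J -> int_line (fun s => c * f s) (c * J).
Proof.
  rewrite !int_line_parts; intros [H1 H2]; split.
  - apply (is_RInt_gen_minus (V := R_NormedModule) (fun s => Re c * Re (f s))%R
      (fun s => Im c * Im (f s))%R (Re c * Re J)%R (Im c * Im J)%R);
    now apply (is_RInt_gen_scal (V := R_NormedModule)).
  - apply (is_RInt_gen_plus (V := R_NormedModule) (fun s => Re c * Im (f s))%R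
      (fun s => Im c * Re (f s))%R (Re c * Im J)%R (Im c * Re J)%R);
    now apply (is_RInt_gen_scal (V := R_NormedModule)).
Qed.

Lemma int_line_ext f g J : (forall s, f s = g s) -> int_line f J -> int_line g J.
Proof.
  intros E H. refine (is_RInt_gen_ext (V := C_R_NormedModule) f g J _ H).
  apply filter_forall; auto.
Qed.

Lemma int_line_unique f I J : int_line f I -> int_line f J -> I = J.
Proof.
  intros H1 H2.
  rewrite <- (is_RInt_gen_unique (V := C_R_CompleteNormedModule) f I H1).
  exact (is_RInt_gen_unique (V := C_R_CompleteNormedModule) f J H2).
Qed.

Lemma is_RInt_gen_primitive (F f : R -> R) (la lb : R) :
  (forall s, is_derive F s (f s)) -> (forall s, continuous f s) ->
  filterlim F (Rbar_locally m_infty) (locally la) ->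
  filterlim F (Rbar_locally p_infty) (locally lb) ->
  is_RInt_gen f (Rbar_locally m_infty) (Rbar_locally p_infty) (lb - la)%R.
Proof.
  intros HF Hf Ha Hb.
  assert (E : forall s, Derive F s = f s) by (intro; now apply is_derive_unique).
  apply (is_RInt_gen_ext (V := R_NormedModule) (Derive F)).
  { apply filter_forall; auto. }
  apply is_RInt_gen_Derive; trivial; apply filter_forall; intros ab s _.
  - eexists; apply HF.
  - apply continuous_ext with (2 := Hf s). now intros.
Qed.

Lemma atan_near (e : R) : (0 < e)%R -> exists M : R,
  (forall x, M < x -> PI / 2 - e < atan x)%R /\ (forall x, x < - M ->
    atan x < - PI / 2 + e)%R.
Proof.
  intros He. assert (HP := PI_RGT_0).
  set (d := Rmin e (PI / 4)).
  assert (Hd : (0 < d <= e /\ d <= PI / 4)%R).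
  { unfold d; repeat split. apply Rmin_pos; lra. apply Rmin_l. apply Rmin_r. }
  (* d <= PI / 4 keeps PI / 2 - d in the range where atan inverts tan. *)
  exists (tan (PI / 2 - d)).
  assert (E : atan (tan (PI / 2 - d)) = (PI / 2 - d)%R) by (apply atan_tan; lra).
  split; intros x Hx.
  - apply atan_increasing in Hx. lra.
  - apply atan_increasing in Hx. rewrite atan_opp in Hx. lra.
Qed.

Lemma is_RInt_gen_inv_1_sqr (B : R) :
  is_RInt_gen (fun s => B / (1 + s ^ 2))%R (Rbar_locally m_infty) (Rbar_locally p_infty)
    (PI * B)%R.
Proof.
  replace (PI * B)%R with (B * (PI / 2) - B * (- PI / 2))%R by field.
  apply is_RInt_gen_primitive with (F := fun s => (B * atan s)%R).
  - intros s. auto_derive. trivial. unfold Rsqr. field. nra.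
  - intros s. apply ex_derive_continuous_R.
    auto_derive. nra.
  - apply (filterlim_comp _ _ _ atan (fun y => B * y)%R _ (locally (- PI / 2)%R)).
    + intros P [e He]. destruct (atan_near e (cond_pos e)) as [M [_ HM]].
      exists (- M)%R. intros x Hx. apply He.
      change (Rabs (atan x - (- PI / 2)) < e)%R. apply Rabs_def1.
      * generalize (HM x Hx); lra.
      * generalize (atan_bound x) (cond_pos e); lra.
    + apply (filterlim_scal_r (K := R_AbsRing) (V := R_NormedModule)).
  - apply (filterlim_comp _ _ _ atan (fun y => B * y)%R _ (locally (PI / 2)%R)).
    + intros P [e He]. destruct (atan_near e (cond_pos e)) as [M [HM _]].
      exists M%R. intros x Hx. apply He.
      change (Rabs (atan x - (PI / 2)) < e)%R. apply Rabs_def1.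
      * generalize (atan_bound x) (cond_pos e); lra.
      * generalize (HM x Hx); lra.
    + apply (filterlim_scal_r (K := R_AbsRing) (V := R_NormedModule)).
Qed.

Lemma dominated_pos f B : dominated f B -> (0 <= B)%R.
Proof.
  intros H. generalize (H 0%R) (Cmod_ge_0 (f 0%R)).
  replace (B / (1 + 0 ^ 2))%R with B by field. lra.
Qed.

Lemma dominated_minus f g A B : dominated f A -> dominated g B ->
  dominated (fun s => f s - g s) (A + B).
Proof.
  intros HA HB s. unfold Rdiv. rewrite Rmult_plus_distr_r.
  apply Rle_trans with (1 := Cmod_triang_minus _ _).
  apply Rplus_le_compat; [apply HA | apply HB].
Qed.

Lemma dominated_scal c f A M : (Cmod c <= M)%R -> dominated f A ->
  dominated (fun s => c * f s) (M * A).
Proof.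
  intros Hc HA s. rewrite Cmod_mult. unfold Rdiv. rewrite Rmult_assoc.
  apply Rmult_le_compat; trivial; try apply Cmod_ge_0; apply HA.
Qed.

Lemma int_line_bound f B J : dominated f B -> int_line f J -> (Cmod J <= PI * B)%R.
Proof.
  intros HB HJ. rewrite Cmod_norm.
  apply (RInt_gen_norm (V := C_R_CompleteNormedModule) (Fa := Rbar_locally m_infty)
   (Fb := Rbar_locally p_infty) f (fun s => B / (1 + s ^ 2))%R).
  - exists (fun x => x < 0)%R (fun x => 0 < x)%R; [now exists 0%R | now exists 0%R |].
    simpl; intros; lra.
  - apply filter_forall. intros ab s _. rewrite <- Cmod_norm. apply HB.
  - exact HJ.
  - apply is_RInt_gen_inv_1_sqr.
Qed.

Lemma path_differentiable_ex_RInt f a b : path_differentiable f -> ex_RInt (V :=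
  C_R_CompleteNormedModule) f a b.
Proof.
  intros H. apply (ex_RInt_continuous (V := C_R_CompleteNormedModule)).
  intros z _. destruct (H z) as [l Hl]. exact (path_derive_continuous _ _ _ Hl).
Qed.

Lemma RInt_dominated_le f B a b : path_differentiable f -> dominated f B ->
  (Cmod (RInt_C f a b) <= B * Rabs (atan b - atan a))%R.
Proof.
  intros Hf HB.
  assert (G : forall a b, (a <= b)%R ->
    (Cmod (RInt_C f a b) <= B * (atan b - atan a))%R).
  { clear a b; intros a b Hab. rewrite Cmod_norm.
    apply (norm_RInt_le (V := C_R_CompleteNormedModule) f (fun s => B / (1 + s ^ 2))%R a b);
    trivial.
    - intros s _. rewrite <- Cmod_norm. apply HB.
    - apply (RInt_correct (V := C_R_CompleteNormedModule)).
      now apply path_differentiable_ex_RInt.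
    - replace (B * (atan b - atan a))%R with (minus (B * atan b) (B * atan a))%R
        by (unfold minus, plus, opp; simpl; ring).
      apply (is_RInt_derive (V := R_CompleteNormedModule) (fun s => B * atan s)%R).
      + intros s _. auto_derive. trivial. unfold Rsqr. field. nra.
      + intros s _. apply ex_derive_continuous_R.
        auto_derive. nra. }
  assert (HB0 := dominated_pos _ _ HB).
  destruct (Rle_dec a b) as [Hab|Hab].
  - apply Rle_trans with (1 := G a b Hab). apply Rmult_le_compat_l; trivial. apply Rle_abs.
  - rewrite <- (opp_RInt_swap (V := C_R_CompleteNormedModule)) by
    now apply path_differentiable_ex_RInt.
    change (Cmod (- RInt_C f b a) <= B * Rabs (atan b - atan a))%R.
    rewrite Cmod_opp, Rabs_minus_sym.
    apply Rle_trans with (1 := G b a ltac:(lra)). apply Rmult_le_compat_l; trivial.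
    apply Rle_abs.
Qed.

(** Cauchy's criterion: beyond a large bound atan varies little, and by
    [RInt_dominated_le] so do the integrals over bounded intervals. *)
Lemma int_line_exists f B : path_differentiable f -> dominated f B -> exists J,
  int_line f J.
Proof.
  intros Hf HB. assert (HB0 := dominated_pos _ _ HB).
  destruct (proj1 (filterlim_locally_cauchy (U := C_R_CompleteNormedModule)
    (F := filter_prod (Rbar_locally m_infty) (Rbar_locally p_infty))
    (fun ab => RInt_C f (fst ab) (snd ab)))) as [J HJ].
  - intros e.
    destruct (atan_near (e / (2 * (B + 1)))) as [M [HM1 HM2]].
    { apply Rdiv_lt_0_compat. apply cond_pos. lra. }
    exists (fun ab => fst ab < - M /\ M < snd ab)%R. split.
    + exists (fun x => x < - M)%R (fun x => M < x)%R.
      now exists (- M)%R. now exists M. now simpl.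
    + intros [a b] [a' b']; simpl; intros [Ha Hb] [Ha' Hb'].
      apply (norm_compat1 (V := C_R_CompleteNormedModule)). rewrite <- Cmod_norm.
      replace (minus _ _) with
       (RInt_C f a' a + RInt_C f b b').
      * assert (H1 := RInt_dominated_le f B a' a Hf HB). assert (H2 :=
        RInt_dominated_le f B b b' Hf HB).
        assert (H3 : (Rabs (atan a - atan a') < e / (2 * (B + 1)))%R).
        { generalize (HM2 a Ha) (HM2 a' Ha') (atan_bound a) (atan_bound a'); intros.
          apply Rabs_def1; lra. }
        assert (H4 : (Rabs (atan b' - atan b) < e / (2 * (B + 1)))%R).
        { generalize (HM1 b Hb) (HM1 b' Hb') (atan_bound b) (atan_bound b'); intros.
          apply Rabs_def1; lra. }
        apply Rle_lt_trans with (1 := Cmod_triangle _ _).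
        assert (H5 : (e = (B + 1) * (e / (2 * (B + 1))) + (B + 1) * (e / (2 * (B + 1))) :>
          R)%R)
          by (field; lra).
        assert (0 <= Rabs (atan a - atan a'))%R by apply Rabs_pos.
        assert (0 <= Rabs (atan b' - atan b))%R by apply Rabs_pos.
        nra.
      * rewrite <- (RInt_Chasles (V := C_R_CompleteNormedModule) f a' a b') by
        now apply path_differentiable_ex_RInt.
        rewrite <- (RInt_Chasles (V := C_R_CompleteNormedModule) f a b b') by
          now apply path_differentiable_ex_RInt.
        generalize (RInt_C f a' a) (RInt_C f a b)
          (RInt_C f b b').
        intros x y z. change (x + z = x + (y + z) - y). ring.
  - exists J. intros P HP. destruct (HJ P HP) as [Q S HQ HS HP'].
    exists Q S; trivial. intros x y Hx Hy. specialize (HP' x y Hx Hy). revert HP'.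
    generalize (x, y); clear x y Hx Hy.
    intros ab Hab. exists (RInt_C f (fst ab) (snd ab)). split; trivial.
    apply (RInt_correct (V := C_R_CompleteNormedModule)).
    now apply path_differentiable_ex_RInt.
Qed.

Lemma dominated_tendsto_0 (u : R -> R) B :
  (forall s : R, Rabs (u s) <= B / (1 + s ^ 2))%R ->
  filterlim u (Rbar_locally m_infty) (locally 0%R) /\
  filterlim u (Rbar_locally p_infty) (locally 0%R).
Proof.
  intros H.
  assert (HB : (0 <= B)%R).
  { generalize (H 0%R) (Rabs_pos (u 0%R)). replace (B / (1 + 0 ^ 2))%R with B by field.
    lra. }
  assert (G : forall (e : posreal) s, (B / e + 1 < Rabs s -> Rabs (u s) < e)%R).
  { intros e s Hs. apply Rle_lt_trans with (1 := H s).
    assert (He := cond_pos e).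
    assert (HBe : (0 <= B / e)%R) by (apply Rdiv_le_0_compat; lra).
    assert (Es : (s ^ 2 = Rabs s * Rabs s)%R).
    { rewrite <- Rabs_mult. rewrite Rabs_right; [simpl; ring | nra]. }
    apply Rmult_lt_reg_r with (1 + s ^ 2)%R. nra.
    replace (B / (1 + s ^ 2) * (1 + s ^ 2))%R with B by (field; nra).
    assert (EB : B = (e * (B / e))%R) by (field; lra).
    assert (B / e < 1 + s ^ 2)%R by nra. nra. }
  split; intros P [e He].
  - exists (- (B / e + 1))%R. intros s Hs. apply He.
    change (Rabs (u s - 0) < e)%R. rewrite Rminus_0_r. apply G.
    apply Rlt_le_trans with (- s)%R. lra. rewrite <- Rabs_Ropp. apply Rle_abs.
  - exists (B / e + 1)%R. intros s Hs. apply He.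
    change (Rabs (u s - 0) < e)%R. rewrite Rminus_0_r. apply G.
    apply Rlt_le_trans with s. lra. apply Rle_abs.
Qed.

(** The boundary values of a dominated primitive tend to 0. *)
Lemma int_line_derivative (F f : R -> C) B :
  (forall s, path_derive F s (f s)) -> path_differentiable f -> dominated F B ->
    int_line f 0.
Proof.
  intros HF Hf HB. apply int_line_parts. split; simpl.
  - destruct (dominated_tendsto_0 (fun s => Re (F s)) B) as [L1 L2].
    { intros s. apply Rle_trans with (2 := HB s). apply re_le_Cmod. }
    rewrite <- (Rminus_0_r 0).
    apply is_RInt_gen_primitive with (F := fun s => Re (F s)); trivial.
    + intros s. apply HF.
    + intros s. destruct (Hf s) as [l [H _]]. 
      apply ex_derive_continuous_R. now exists (Re l).
  - destruct (dominated_tendsto_0 (fun s => Im (F s)) B) as [L1 L2].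
    { intros s. apply Rle_trans with (2 := HB s). apply im_le_Cmod. }
    rewrite <- (Rminus_0_r 0).
    apply is_RInt_gen_primitive with (F := fun s => Im (F s)); trivial.
    + intros s. apply HF.
    + intros s. destruct (Hf s) as [l [_ H]]. 
      apply ex_derive_continuous_R. now exists (Im l).
Qed.

(** * The logarithm on the right half-plane *)

(** The principal logarithm on Re t > 0, in a form that is differentiated directly;
    see [Clog_eq_right]. *)
Definition Clog_right (t : C) : C := (ln (Cmod t), atan (Im t / Re t)).

Lemma exp_le x y : (x <= y)%R -> (exp x <= exp y)%R.
Proof. intros [H|H]. left. now apply exp_increasing. now rewrite H; right. Qed.

Lemma ln_le_self x : (0 < x)%R -> (ln x <= x)%R.
Proof.
  intros H. rewrite <- (ln_exp x) at 2. apply ln_le; trivial.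
  generalize (exp_ineq1_le x). lra.
Qed.

Lemma Rabs_ln_le x : (0 < x)%R -> (Rabs (ln x) <= x + / x)%R.
Proof.
  intros H. assert (Hi := Rinv_0_lt_compat _ H).
  generalize (ln_le_self x H) (ln_le_self (/ x) Hi). rewrite ln_Rinv by trivial.
  intros. apply Rabs_le. lra.
Qed.

Lemma Re_pos_neq_0 (t : C) : (0 < Re t)%R -> t <> 0.
Proof. intros H E. rewrite E in H. simpl in H. lra. Qed.

Lemma Re_pos_Cmod (t : C) : (0 < Re t)%R -> (0 < Cmod t)%R.
Proof. intros H. apply Cmod_gt_0. now apply Re_pos_neq_0. Qed.

Lemma cos_sin_atan_quotient (x y r : R) : (0 < x)%R -> (0 < r)%R ->
  (r * r = x * x + y * y)%R ->
  cos (atan (y / x)) = (x / r)%R /\ sin (atan (y / x)) = (y / r)%R.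
Proof.
  intros Hx Hr E. 
  rewrite cos_atan, sin_atan.
  assert (S : sqrt (1 + (y / x)²) = (r / x)%R).
  { replace (1 + (y / x)²)%R with ((r / x)²)%R.
    - apply sqrt_Rsqr. apply Rdiv_le_0_compat; lra.
    - unfold Rsqr. field_simplify; try lra. rewrite <- !Rsqr_pow2; unfold Rsqr. rewrite E.
      f_equal; ring. }
  rewrite S. split; field; lra.
Qed.

Lemma Cexp_Clog_right t : (0 < Re t)%R -> Cexp (Clog_right t) = t.
Proof.
  intros H. assert (Hm := Re_pos_Cmod _ H).
  destruct (cos_sin_atan_quotient (Re t) (Im t) (Cmod t) H Hm (Cmod_sqr t)) as [E1 E2].
  apply Ceq_parts; partsr; simpl; rewrite ?E1, ?E2, exp_ln by assumption; field; lra.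
Qed.

Lemma Clog_right_R (x : R) : (0 < x)%R -> Clog_right x = RtoC (ln x).
Proof.
  intros H. unfold Clog_right. rewrite Cmod_R, Rabs_right by lra. simpl.
  replace (0 / x)%R with 0%R by (field; lra). rewrite atan_0. reflexivity.
Qed.

Lemma Im_Clog_right_bound t : (- (PI / 2) < Im (Clog_right t) < PI / 2)%R.
Proof. simpl. generalize (atan_bound (Im t / Re t)). lra. Qed.

Lemma Clog_Cexp (l : C) : (- PI < Im l <= PI)%R -> Clog (Cexp l) = l.
Proof.
  intros H. unfold Clog. rewrite Cmod_Cexp, ln_exp.
  apply Ceq_parts; simpl; trivial.
  unfold Carg. rewrite Cmod_Cexp, Re_Cexp, Im_Cexp.
  assert (He := exp_pos (Re l)).
  replace (exp (Re l) * cos (Im l) / exp (Re l))%R with (cos (Im l)) by (field; lra).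
  destruct (Rlt_le_dec (Im l) 0) as [Hi|Hi].
  - assert (Hs : (sin (Im l) < 0)%R).
    { replace (Im l) with (- (- Im l))%R by ring. rewrite sin_neg.
      generalize (sin_gt_0 (- Im l) ltac:(lra) ltac:(lra)). lra. }
    destruct Rle_dec as [Hd|_]. nra.
    rewrite <- cos_neg, acos_cos; lra.
  - assert (Hs := sin_ge_0 (Im l) Hi (proj2 H)).
    destruct Rle_dec as [_|Hd]. 2: nra.
    apply acos_cos. lra.
Qed.

Lemma Clog_eq_right t : (0 < Re t)%R -> Clog t = Clog_right t.
Proof.
  intros H. rewrite <- (Cexp_Clog_right t H) at 1. apply Clog_Cexp.
  generalize (Im_Clog_right_bound t) PI_RGT_0. lra.
Qed.

(** The arguments of t and t0 lie in (-pi/2, pi/2), so their difference is still a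
    principal argument, although t / t0 may leave the right half-plane. *)
Lemma Clog_quotient (t0 t : C) : (0 < Re t0)%R -> (0 < Re t)%R ->
  Clog (t / t0) = Clog_right t - Clog_right t0.
Proof.
  intros H0 H.
  rewrite <- (Cexp_Clog_right t H) at 1. rewrite <- (Cexp_Clog_right t0 H0) at 1.
  unfold Cdiv. rewrite <- Cexp_opp, <- Cexp_plus. apply Clog_Cexp.
  rewrite Im_minus. generalize (Im_Clog_right_bound t) (Im_Clog_right_bound t0). lra.
Qed.

(** Makes the power t^(-al) grow at most like exp (|al| |t|) away from the
    imaginary axis. *)
Lemma Re_mult_Clog_right_le al t r : (0 < r <= Re t)%R ->
  (Rabs (Re (al * Clog_right t)) <= Cmod al * (Cmod t + / r + PI))%R.
Proof.
  intros [Hr Ht]. apply Rle_trans with (1 := Re_prod_le _ _).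
  apply Rmult_le_compat_l. apply Cmod_ge_0.
  assert (Hm : (r <= Cmod t)%R).
  { apply Rle_trans with (1 := Ht). apply Rle_trans with (2 := re_le_Cmod t).
    apply Rle_abs. }
  apply Rle_trans with (1 := Cmod_le_parts _). simpl.
  generalize (Rabs_ln_le (Cmod t) ltac:(lra)) (Rinv_le_contravar r (Cmod t) Hr Hm).
  assert (Rabs (atan (Im t / Re t)) <= PI)%R.
  { destruct (atan_bound (Im t / Re t)). assert (HP := PI_RGT_0). apply Rabs_le. lra. }
  lra.
Qed.

Lemma path_derive_Clog_right q x l : path_derive q x l -> (0 < Re (q x))%R ->
  path_derive (fun s => Clog_right (q s)) x (l / q x).
Proof.
  intros [H1 H2] Hp.
  assert (G : forall (u v : R -> R) (u' v' : R), is_derive u x u' -> is_derive v x v' ->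
    (0 < u x)%R ->
    is_derive (fun s => ln (sqrt (u s ^ 2 + v s ^ 2)))%R x
      ((u' * u x + v' * v x) / (u x ^ 2 + v x ^ 2))%R /\
    is_derive (fun s => atan (v s / u s))%R x
      ((v' * u x - u' * v x) / (u x ^ 2 + v x ^ 2))%R).
  { intros u v u' v' Hu Hv Hpos.
    assert (Hn : (0 < u x * (u x * 1) + v x * (v x * 1))%R) by nra.
    assert (Hs := sqrt_lt_R0 _ Hn).
    split; auto_derive.
    - repeat split; trivial; eexists; eassumption.
    - rewrite (is_derive_unique (fun s : R => u s) _ _ Hu),
      (is_derive_unique (fun s : R => v s) _ _ Hv).
      set (w := sqrt _) in *.
      assert (Ew : (u x ^ 2 + v x ^ 2 = w * w)%R) by (unfold w; rewrite sqrt_sqrt; lra).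
      rewrite Ew. field. lra.
    - repeat split; try (eexists; eassumption). lra.
    - rewrite (is_derive_unique (fun s : R => u s) _ _ Hu),
      (is_derive_unique (fun s : R => v s) _ _ Hv).
      field. split; nra. }
  destruct (G _ _ _ _ H1 H2 Hp) as [G1 G2].
  assert (Hn : (0 < Re (q x) * Re (q x) + Im (q x) * Im (q x))%R) by nra.
  split.
  - replace (Re (l / q x)) with ((Re l * Re (q x) + Im l * Im (q x)) /
      (Re (q x) ^ 2 + Im (q x) ^ 2))%R by
      (unfold Cdiv, Cinv; partsr; simpl; fold (Re (q x)) (Im (q x)); field; lra).
    exact G1.
  - replace (Im (l / q x)) with ((Im l * Re (q x) - Re l * Im (q x)) /
      (Re (q x) ^ 2 + Im (q x) ^ 2))%R by
      (unfold Cdiv, Cinv; partsr; simpl; fold (Re (q x)) (Im (q x)); field; lra).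
    exact G2.
Qed.

(** * The integrand of the contour representation *)

Definition integrand (al z t : C) : C := Cexp (t * t / 2 - z * t - al * Clog_right t).

(** The derivative of the integrand in t, written as a combination of integrands
    with shifted parameter. *)
Definition integrand_dt (al z t : C) : C :=
  integrand (al - 1) z t - z * integrand al z t - al * integrand (al + 1) z t.
Definition integrand_dt2 (al z t : C) : C :=
  integrand_dt (al - 1) z t - z * integrand_dt al z t - al * integrand_dt (al + 1) z t.

(** This shift of the parameter lets one family of functions be closed under all the
    differentiations below. *)
Lemma integrand_pred al z t : (0 < Re t)%R -> integrand (al - 1) z t = t * integrand al z t.
Proof.
  intros H. unfold integrand.
  replace (t * t / 2 - z * t - (al - 1) * Clog_right t) with
    (Clog_right t + (t * t / 2 - z * t - al * Clog_right t)) by ring.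
  rewrite Cexp_plus, Cexp_Clog_right; trivial.
Qed.

Lemma integrand_succ al z t : (0 < Re t)%R -> integrand (al + 1) z t = integrand al z t / t.
Proof.
  intros H. replace al with (al + 1 - 1) at 2 by ring. rewrite integrand_pred by trivial.
  field. now apply Re_pos_neq_0.
Qed.

Lemma path_derive_integrand_t al z q x l : path_derive q x l -> (0 < Re (q x))%R ->
  path_derive (fun s => integrand al z (q s)) x (l * integrand_dt al z (q x)).
Proof.
  intros H Hp. unfold integrand at 1. eapply path_derive_eq.
  - apply path_derive_Cexp. apply path_derive_minus.
    + apply path_derive_minus; [|apply path_derive_scal; exact H].
      apply path_derive_mult; [|apply path_derive_const]. apply path_derive_mult; exact H.
    + apply path_derive_scal. apply path_derive_Clog_right. exact H. exact Hp.
  - cbv beta. fold (integrand al z (q x)). unfold integrand_dt. rewrite integrand_pred,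
    integrand_succ by trivial.
    field. now apply Re_pos_neq_0.
Qed.

Lemma path_derive_integrand_dt al z q x l : path_derive q x l -> (0 < Re (q x))%R ->
  path_derive (fun s => integrand_dt al z (q s)) x (l * integrand_dt2 al z (q x)).
Proof.
  intros H Hp. eapply path_derive_eq.
  - apply path_derive_minus; [apply path_derive_minus|];
    [|apply path_derive_scal|apply path_derive_scal];
    apply path_derive_integrand_t; eassumption.
  - unfold integrand_dt2. ring.
Qed.

Lemma path_derive_integrand_z al t q x l : (0 < Re t)%R -> path_derive q x l ->
  path_derive (fun s => integrand al (q s) t) x (- l * integrand (al - 1) (q x) t).
Proof.
  intros Hp H. unfold integrand at 1. eapply path_derive_eq.
  - apply path_derive_Cexp. apply path_derive_minus; [|apply path_derive_const].
    apply path_derive_minus; [apply path_derive_const|]. apply path_derive_mult. exact H.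
    apply path_derive_const.
  - cbv beta. fold (integrand al (q x) t). rewrite integrand_pred by trivial. ring.
Qed.

Lemma Re_vertical p (s : R) : Re (p + s * Ci) = Re p.
Proof. partsr. ring. Qed.

Lemma vertical_sqr (p : C) (s : R) :
  (p + s * Ci) * (p + s * Ci) = p * p + 2 * s * Ci * p - s ^ 2.
Proof.
  apply Ceq_parts; rewrite <- ?RtoC_pow; partsr; simpl; ring.
Qed.

(** Complete the square, B |s| <= B^2 + s^2/4, and use 1 + s^2/4 <= exp (s^2/4). *)
Lemma exp_quadratic_le A B s :
  (exp (A + B * Rabs s - s ^ 2 / 2) <= 4 * exp (A + B ^ 2) / (1 + s ^ 2))%R.
Proof.
  assert (Hs : (s ^ 2 = Rabs s ^ 2)%R) by (symmetry; apply pow2_abs).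
  apply Rle_trans with (exp (A + B ^ 2) * exp (- (s ^ 2 / 4)))%R.
  { rewrite <- exp_plus. apply exp_le. rewrite Hs.
    assert (0 <= (2 * B - Rabs s) ^ 2)%R by apply pow2_ge_0. nra. }
  rewrite exp_Ropp.
  assert (He := exp_ineq1_le (s ^ 2 / 4)).
  assert (Hp := exp_pos (A + B ^ 2)).
  assert (H0 : (0 <= s ^ 2)%R) by apply pow2_ge_0.
  replace (4 * exp (A + B ^ 2) / (1 + s ^ 2))%R with
    (exp (A + B ^ 2) * / ((1 + s ^ 2) / 4))%R
    by (field; nra).
  apply Rmult_le_compat_l. lra. apply Rinv_le_contravar; lra.
Qed.

(** On t = p + i s the real part of t^2/2 is -s^2/2 up to terms linear in |s|, and
    all the other terms of the exponent are at most linear in |s|. *)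
Lemma integrand_dominated al r M : (0 < r)%R -> exists D, forall z p, (Cmod z <= M)%R ->
  (Cmod p <= M)%R -> (r <= Re p)%R -> dominated (fun s => integrand al z (p + s * Ci)) D.
Proof.
  intros Hr.
  exists (4 * exp ((M ^ 2 / 2 + M ^ 2 + Cmod al * (M + / r + PI)) + (2 * M + Cmod al) ^
    2))%R.
  intros z p Hz Hp Hrp s.
  unfold integrand. rewrite Cmod_Cexp. apply Rle_trans with (2 := exp_quadratic_le _ _ _).
  apply exp_le.
  set (t := p + s * Ci).
  assert (Rt : Re t = Re p) by (unfold t; partsr; ring).
  assert (It : Im t = (Im p + s)%R) by (unfold t; partsr; ring).
  assert (HL := Re_mult_Clog_right_le al t r ltac:(lra)).
  assert (Mt : (Cmod t <= M + Rabs s)%R).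
  { apply Rle_trans with (1 := Cmod_triangle _ _).
    rewrite Cmod_mult, Cmod_R, Cmod_Ci. lra. }
  assert (HZ := Re_prod_le z t).
  rewrite !Re_minus.
  assert (Hsq : Re (t * t / 2) = ((Re p * Re p - (Im p + s) * (Im p + s)) / 2)%R).
  { unfold Cdiv. rewrite <- (RtoC_inv 2) by lra. partsr. rewrite Rt, It. field. }
  rewrite Hsq.
  apply Rabs_le_between in HL. apply Rabs_le_between in HZ.
  assert (Ha := Cmod_ge_0 al). assert (Hz0 := Cmod_ge_0 z). assert (Hp0 := Cmod_ge_0 p).
  assert (Hs := Rabs_pos s).
  assert (Hzt : (Cmod z * Cmod t <= M * (M + Rabs s))%R).
  { apply Rmult_le_compat; trivial. apply Cmod_ge_0. }
  assert (Hat : (Cmod al * (Cmod t + / r + PI) <= Cmod al * (M + Rabs s + / r + PI))%R).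
  { apply Rmult_le_compat_l; lra. }
  assert (HR2 : (Re p * Re p <= M ^ 2)%R).
  { generalize (Cmod_sqr p). nra. }
  assert (HI : (- (Im p * s) <= M * Rabs s)%R).
  { rewrite Ropp_mult_distr_l. apply Rle_trans with (1 := Rle_abs _).
    rewrite Rabs_mult, Rabs_Ropp. apply Rmult_le_compat_r; trivial.
    apply Rle_trans with (1 := im_le_Cmod p). trivial. }
  nra.
Qed.

(** The uniformity in z and p is what lets the Taylor remainders below be dominated. *)
Definition locally_dominated (F : C -> C -> C -> C) : Prop :=
  forall (al : C) (r M : R), (0 < r)%R -> exists D, forall z p, (Cmod z <= M)%R ->
  (Cmod p <= M)%R -> (r <= Re p)%R -> dominated (fun s => F al z (p + s * Ci)) D.

Lemma locally_dominated_comb F : locally_dominated F ->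
  locally_dominated (fun al z t => F (al - 1) z t - z * F al z t - al * F (al + 1) z t).
Proof.
  intros HF al r M Hr.
  destruct (HF (al - 1) r M Hr) as [D1 H1].
  destruct (HF al r M Hr) as [D2 H2].
  destruct (HF (al + 1) r M Hr) as [D3 H3].
  exists ((D1 + M * D2) + Cmod al * D3)%R. intros z p Hz Hp Hrp.
  apply dominated_minus; [apply dominated_minus|].
  - now apply H1.
  - apply dominated_scal; trivial. now apply H2.
  - apply dominated_scal. apply Rle_refl. now apply H3.
Qed.

Lemma locally_dominated_integrand : locally_dominated integrand.
Proof. exact integrand_dominated. Qed.

Lemma locally_dominated_dt : locally_dominated integrand_dt.
Proof. exact (locally_dominated_comb integrand locally_dominated_integrand). Qed.

Lemma locally_dominated_dt2 : locally_dominated integrand_dt2.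
Proof. exact (locally_dominated_comb integrand_dt locally_dominated_dt). Qed.

Lemma path_differentiable_integrand al z p : (0 < Re p)%R ->
  path_differentiable (fun s => integrand al z (p + s * Ci)).
Proof.
  intros H s. eexists. apply path_derive_integrand_t. apply path_derive_line.
  now rewrite Re_vertical.
Qed.

Lemma integrand_dominated_at al z p : (0 < Re p)%R -> exists D,
  dominated (fun s => integrand al z (p + s * Ci)) D.
Proof.
  intros H. destruct (locally_dominated_integrand al (Re p) (Rmax (Cmod z) (Cmod p)) H) as
    [D HD].
  exists D. apply HD. apply Rmax_l. apply Rmax_r. apply Rle_refl.
Qed.

(** * The integral along a vertical line *)

Definition line_integral (al z p : C) : C :=
  RInt_gen (V := C_R_CompleteNormedModule) (fun s => integrand al z (p + s * Ci))
    (Rbar_locally m_infty) (Rbar_locally p_infty).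

Lemma line_integral_correct al z p : (0 < Re p)%R ->
  int_line (fun s => integrand al z (p + s * Ci)) (line_integral al z p).
Proof.
  intros H. destruct (integrand_dominated_at al z p H) as [D HD].
  destruct (int_line_exists _ D (path_differentiable_integrand al z p H) HD) as [J HJ].
  exact (RInt_gen_correct (V := C_R_CompleteNormedModule)
    (fun s : R => integrand al z (p + s * Ci)) (ex_intro _ J HJ)).
Qed.

Lemma int_line_integrand_dt al z p : (0 < Re p)%R ->
  int_line (fun s => integrand_dt al z (p + s * Ci)) 0.
Proof.
  intros H. destruct (integrand_dominated_at al z p H) as [D HD].
  (* The derivative of s |-> integrand at p + i s carries a factor i. *)
  apply int_line_ext with (fun s => - Ci * (Ci * integrand_dt al z (p + s * Ci))).
  { intros s. replace (- Ci * (Ci * integrand_dt al z (p + s * Ci))) with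
     (- (Ci * Ci) * integrand_dt al z (p + s * Ci)) by ring.
    replace (Ci * Ci) with (- (1)) by (apply Ceq_parts; partsr; ring). ring. }
  replace (RtoC 0) with (- Ci * 0) by ring. apply int_line_scal.
  apply int_line_derivative with (fun s => integrand al z (p + s * Ci)) D; trivial.
  - intros s. apply (path_derive_integrand_t al z (fun s => p + s * Ci)).
    apply path_derive_line. now rewrite Re_vertical.
  - intros s. eexists. apply path_derive_scal. apply path_derive_integrand_dt.
    apply path_derive_line. now rewrite Re_vertical.
Qed.

(** The integral of the derivative of the integrand in t vanishes. *)
Lemma line_integral_recurrence al z p : (0 < Re p)%R ->
  line_integral (al - 1) z p - z * line_integral al z p - al * line_integral (al + 1) z p =
    0.
Proof.
  intros H. apply int_line_unique with (fun s => integrand_dt al z (p + s * Ci)).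
  2: now apply int_line_integrand_dt.
  unfold integrand_dt. apply int_line_minus; [apply int_line_minus|];
  [|apply int_line_scal|apply int_line_scal]; now apply line_integral_correct.
Qed.

(** The second derivative of the integrand in z is the integrand with parameter
    al - 2, so the Taylor remainder of order 2 is dominated and can be integrated. *)
Lemma line_integral_taylor_z al z p : (0 < Re p)%R -> exists B, forall h : C,
  (Cmod h <= 1)%R ->
  (Cmod (line_integral al (z + h) p - line_integral al z p - (- h) * line_integral (al - 1)
    z p) <= B * Cmod h ^ 2)%R.
Proof.
  intros Hp.
  destruct (locally_dominated_integrand (al - 1 - 1) (Re p) (Rmax (Cmod z + 1) (Cmod p))
    Hp) as [D HD].
  exists (PI * (4 * D))%R. intros h Hh.
  replace (PI * (4 * D) * Cmod h ^ 2)%R with (PI * (4 * (Cmod h ^ 2 * D)))%R by ring.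
  apply int_line_bound with
    (fun s => integrand al (z + h) (p + s * Ci) - integrand al z (p + s * Ci) - (- h) *
      integrand (al - 1) z (p + s * Ci)).
  2: { apply int_line_minus; [apply int_line_minus|apply int_line_scal];
    now apply line_integral_correct. }
  intros s. set (t := p + s * Ci).
  assert (Ht : (0 < Re t)%R) by (unfold t; now rewrite Re_vertical).
  replace (4 * (Cmod h ^ 2 * D) / (1 + s ^ 2))%R with
    (4 * (Cmod h ^ 2 * (D / (1 + s ^ 2))))%R
    by (unfold Rdiv; ring).
  replace (integrand al (z + h) t) with (integrand al (z + 1%R * h) t) by (f_equal; ring).
  replace (integrand al z t) with (integrand al (z + 0%R * h) t) at 1 by (f_equal; ring).
  replace (integrand (al - 1) z t) with (integrand (al - 1) (z + 0%R * h) t) by (f_equal;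
    ring).
  apply (taylor_order2_ineq (fun x => integrand al (z + x * h) t) (fun x => - h * integrand
    (al - 1) (z + x * h) t)
    (fun x => - h * (- h * integrand (al - 1 - 1) (z + x * h) t))).
  - intros x _. apply (path_derive_integrand_z al t (fun x => z + x * h)); trivial.
    apply path_derive_line.
  - intros x _. apply path_derive_scal.
    apply (path_derive_integrand_z (al - 1) t (fun x => z + x * h)); trivial.
    apply path_derive_line.
  - intros x Hx. rewrite !Cmod_mult, Cmod_opp.
    replace (Cmod h ^ 2 * (D / (1 + s ^ 2)))%R with
      (Cmod h * (Cmod h * (D / (1 + s ^ 2))))%R by ring.
    apply Rmult_le_compat_l. apply Cmod_ge_0. apply Rmult_le_compat_l. apply Cmod_ge_0.
    apply HD.
    + apply Rle_trans with (2 := Rmax_l _ _).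
      apply Rle_trans with (1 := Cmod_triangle _ _). apply Rplus_le_compat_l.
      rewrite Cmod_mult, Cmod_R, Rabs_right by lra.
      generalize (Cmod_ge_0 h). nra.
    + apply Rmax_r.
    + apply Rle_refl.
Qed.

Lemma path_derive_line_integral_z al z p d x : (0 < Re p)%R ->
  path_derive (fun s => line_integral al (z + s * d) p) x (- d * line_integral (al - 1) (z
    + x * d) p).
Proof.
  intros Hp. destruct (line_integral_taylor_z al (z + x * d) p Hp) as [B HB].
  assert (Hd := Cmod_ge_0 d).
  apply path_derive_of_quadratic with (B * Cmod d ^ 2)%R (/ (1 + Cmod d))%R.
  { apply Rinv_0_lt_compat. lra. }
  intros h Hh.
  assert (Hhd : (Cmod (h * d) <= 1)%R).
  { rewrite Cmod_mult, Cmod_R. apply Rle_trans with (/ (1 + Cmod d) * Cmod d)%R.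
    - now apply Rmult_le_compat_r.
    - apply Rmult_le_reg_l with (1 + Cmod d)%R. lra.
      rewrite <- Rmult_assoc, Rinv_r by lra. lra. }
  specialize (HB _ Hhd). rewrite Cmod_mult, Cmod_R, Rpow_mult_distr, pow2_abs in HB.
  apply Rle_trans with (B * (h ^ 2 * Cmod d ^ 2))%R; [|right; ring].
  apply Rle_trans with (2 := HB). right. f_equal.
  replace (z + (x + h)%R * d) with (z + x * d + h * d) by (rewrite RtoC_plus; ring). ring.
Qed.

(** The linear term in h of the Taylor expansion of the integrand is h times its
    derivative in t, whose integral is 0; only the quadratic remainder is left. *)
Lemma line_integral_taylor_p al z p : (0 < Re p)%R -> exists B, forall h : C,
  (Cmod h <= Re p / 2)%R ->
  (Cmod (line_integral al z (p + h) - line_integral al z p) <= B * Cmod h ^ 2)%R.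
Proof.
  intros Hp.
  destruct (locally_dominated_dt2 al (Re p / 2)%R (Rmax (Cmod z) (Cmod p + Re p / 2))
    ltac:(lra)) as [D HD].
  exists (PI * (4 * D))%R. intros h Hh.
  assert (Hre : forall x : R, (0 <= x <= 1)%R -> (Cmod (x * h) <= Re p / 2)%R).
  { intros x Hx. rewrite Cmod_mult, Cmod_R, Rabs_right by lra. generalize (Cmod_ge_0 h).
    nra. }
  assert (Hre2 : forall x : R, (0 <= x <= 1)%R -> (Re p / 2 <= Re (p + x * h))%R).
  { intros x Hx. rewrite Re_plus.
    generalize (Hre x Hx) (re_le_Cmod (x * h)) (Rabs_le_between (Re (x * h)) (Rabs (Re (x *
      h)))).
    intros H1 H2 [H3 _]. specialize (H3 (Rle_refl _)). lra. }
  replace (PI * (4 * D) * Cmod h ^ 2)%R with (PI * (4 * (Cmod h ^ 2 * D)))%R by ring.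
  replace (line_integral al z (p + h) - line_integral al z p) with
    (line_integral al z (p + h) - line_integral al z p - h * 0) by ring.
  apply int_line_bound with
    (fun s => integrand al z (p + h + s * Ci) - integrand al z (p + s * Ci) - h *
      integrand_dt al z (p + s * Ci)).
  2: { apply int_line_minus; [apply int_line_minus|apply int_line_scal].
       - apply line_integral_correct. generalize (Hre2 1%R ltac:(lra)).
         replace (p + 1%R * h) with (p + h) by ring. lra.
       - now apply line_integral_correct.
       - now apply int_line_integrand_dt. }
  intros s.
  replace (4 * (Cmod h ^ 2 * D) / (1 + s ^ 2))%R with
    (4 * (Cmod h ^ 2 * (D / (1 + s ^ 2))))%R
    by (unfold Rdiv; ring).
  replace (p + h + s * Ci) with (p + s * Ci + 1%R * h) by ring.
  replace (integrand al z (p + s * Ci)) with (integrand al z (p + s * Ci + 0%R * h)) by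
    (f_equal; ring).
  replace (integrand_dt al z (p + s * Ci)) with
    (integrand_dt al z (p + s * Ci + 0%R * h)) by (f_equal; ring).
  assert (Hsw : forall x : R, p + s * Ci + x * h = p + x * h + s * Ci) by (intros; ring).
  apply (taylor_order2_ineq (fun x => integrand al z (p + s * Ci + x * h)) (fun x => h *
    integrand_dt al z (p + s * Ci + x * h))
    (fun x => h * (h * integrand_dt2 al z (p + s * Ci + x * h)))).
  - intros x Hx. apply (path_derive_integrand_t al z (fun x => p + s * Ci + x * h)).
    apply path_derive_line.
    rewrite Hsw, Re_vertical. generalize (Hre2 x Hx). lra.
  - intros x Hx. apply path_derive_scal.
    apply (path_derive_integrand_dt al z (fun x => p + s * Ci + x * h)).
    apply path_derive_line.
    rewrite Hsw, Re_vertical. generalize (Hre2 x Hx). lra.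
  - intros x Hx. rewrite !Cmod_mult, Hsw.
    replace (Cmod h ^ 2 * (D / (1 + s ^ 2)))%R with
      (Cmod h * (Cmod h * (D / (1 + s ^ 2))))%R by ring.
    apply Rmult_le_compat_l. apply Cmod_ge_0. apply Rmult_le_compat_l. apply Cmod_ge_0.
    apply HD.
    + apply Rmax_l.
    + apply Rle_trans with (2 := Rmax_r _ _).
      apply Rle_trans with (1 := Cmod_triangle _ _). generalize (Hre x Hx). lra.
    + now apply Hre2.
Qed.

(** Cauchy's theorem for vertical lines: by [line_integral_taylor_p] the derivative
    in p is 0 along the segment from p to q. *)
Lemma line_integral_path_independent al z p q : (0 < Re p)%R -> (0 < Re q)%R ->
  line_integral al z p = line_integral al z q.
Proof.
  intros Hp Hq.
  set (f := fun s : R => line_integral al z (p + s * (q - p))).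
  assert (H : (Cmod (f 1%R - f 0%R) <= 2 * 0 * Rabs (1 - 0))%R).
  { apply mean_value_ineq with (fun _ => 0).
    2: { intros. rewrite Cmod_0. lra. }
    rewrite Rmin_left, Rmax_right by lra. intros s Hs.
    assert (Hre : (0 < Re (p + s * (q - p)))%R).
    { replace (Re (p + s * (q - p))) with ((1 - s) * Re p + s * Re q)%R by (partsr; ring).
      destruct (Req_dec s 0) as [->|H0]; nra. }
    destruct (line_integral_taylor_p al z _ Hre) as [B HB].
    assert (Hd := Cmod_ge_0 (q - p)).
    apply path_derive_of_quadratic with (B * Cmod (q - p) ^ 2)%R 
      (Re (p + s * (q - p)) / 2 / (1 + Cmod (q - p)))%R.
    { apply Rdiv_lt_0_compat; lra. }
    intros h Hh.
    assert (Hhd : (Cmod (h * (q - p)) <= Re (p + s * (q - p)) / 2)%R).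
    { rewrite Cmod_mult, Cmod_R.
      apply Rle_trans with (Re (p + s * (q - p)) / 2 / (1 + Cmod (q - p)) * Cmod (q - p))%R.
      - now apply Rmult_le_compat_r.
      - apply Rmult_le_reg_l with (1 + Cmod (q - p))%R. lra.
        field_simplify; lra. }
    specialize (HB _ Hhd). rewrite Cmod_mult, Cmod_R, Rpow_mult_distr, pow2_abs in HB.
    apply Rle_trans with (B * (h ^ 2 * Cmod (q - p) ^ 2))%R; [|right; ring].
    apply Rle_trans with (2 := HB). right. f_equal. unfold f.
    replace (p + (s + h)%R * (q - p)) with (p + s * (q - p) + h * (q - p))
      by (rewrite RtoC_plus; ring). ring. }
  assert (E1 : f 1%R = line_integral al z q) by (unfold f; f_equal; ring).
  assert (E0 : f 0%R = line_integral al z p) by (unfold f; f_equal; ring).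
  rewrite E1, E0 in H.
  symmetry. apply Ceq_minus. apply Cmod_eq_0.
  generalize (Cmod_ge_0 (line_integral al z q - line_integral al z p)). lra.
Qed.

Open Scope R_scope.

(** * The Gaussian integral *)

Definition gauss (t : R) : R := exp (- (t ^ 2 / 2)).

Lemma continuous_gauss t : continuous gauss t.
Proof.
  apply ex_derive_continuous_R. unfold gauss. auto_derive. trivial.
Qed.

Lemma ex_RInt_gauss a b : ex_RInt gauss a b.
Proof. apply (ex_RInt_continuous (V := R_CompleteNormedModule)). intros.
apply continuous_gauss. Qed.

Definition gauss_int (x : R) : R := RInt gauss 0 x.
(** The square of the integral of gauss over [0, x] and twice the integral of
    [gauss_aux x] over [0, 1] have opposite derivatives in x, which evaluates the
    Gaussian integral without double integrals. *)
Definition gauss_aux (x t : R) : R := exp (- (x ^ 2 * (1 + t ^ 2) / 2)) / (1 + t ^ 2).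

Lemma is_derive_gauss_int x : is_derive gauss_int x (gauss x).
Proof.
  apply (is_derive_RInt (V := R_CompleteNormedModule) gauss gauss_int 0 x).
  - apply filter_forall. intros y. apply (RInt_correct (V := R_CompleteNormedModule)).
    apply ex_RInt_gauss.
  - apply continuous_gauss.
Qed.

Lemma is_derive_gauss_aux x t :
  is_derive (fun x => gauss_aux x t) x (- x * exp (- (x ^ 2 * (1 + t ^ 2) / 2))).
Proof.
  assert (0 < 1 + t ^ 2) by nra.
  unfold gauss_aux. auto_derive. nra. change (x * (x * 1) * (1 + t * (t * 1)) * / 2) with
    (x ^ 2 * (1 + t ^ 2) / 2). field. nra.
Qed.

Lemma ex_RInt_gauss_aux x : ex_RInt (gauss_aux x) 0 1.
Proof.
  apply (ex_RInt_continuous (V := R_CompleteNormedModule)). intros t _.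
  apply ex_derive_continuous_R. unfold gauss_aux. auto_derive. nra.
Qed.

Lemma is_derive_gauss_aux_int x :
  is_derive (fun x => RInt (gauss_aux x) 0 1) x (- (gauss x * gauss_int x)).
Proof.
  replace (- (gauss x * gauss_int x)) with
    (RInt (fun t => Derive (fun u => gauss_aux u t) x) 0 1).
  - apply (is_derive_RInt_param gauss_aux).
    + apply filter_forall. intros y t _. eexists. apply is_derive_gauss_aux.
    + intros t _.
      apply continuity_2d_pt_ext with (fun x t => - x * exp (- (x ^ 2 * (1 + t ^ 2) / 2))).
      { intros u v. symmetry. apply is_derive_unique, is_derive_gauss_aux. }
      apply continuity_2d_pt_mult.
      * apply continuity_2d_pt_opp, continuity_2d_pt_id1.
      * apply (continuity_1d_2d_pt_comp exp). 
        { apply derivable_continuous_pt, derivable_pt_exp. }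
        apply continuity_2d_pt_opp. unfold Rdiv.
        apply continuity_2d_pt_mult; [|apply continuity_2d_pt_const].
        apply continuity_2d_pt_mult; [|apply continuity_2d_pt_plus;
          [apply continuity_2d_pt_const|]];
        simpl; (apply continuity_2d_pt_mult; [|apply continuity_2d_pt_mult;
          [|apply continuity_2d_pt_const]]);
        (apply continuity_2d_pt_id1 || apply continuity_2d_pt_id2).
    + apply filter_forall. intros y. apply ex_RInt_gauss_aux.
  - (* The substitution u = x t turns the integral over [0, 1] into one over [0, x]. *)
    rewrite (RInt_ext _ (fun t => scal (- gauss x) (scal x (gauss (x * t + 0))))).
    + rewrite (RInt_scal (V := R_CompleteNormedModule)).
      2: { apply (ex_RInt_comp_lin (V := R_NormedModule) gauss). apply ex_RInt_gauss. }
      rewrite (RInt_comp_lin (V := R_CompleteNormedModule)) by apply ex_RInt_gauss.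
      unfold gauss_int. rewrite Rmult_0_r, Rmult_1_r, !Rplus_0_r.
      unfold scal; simpl; unfold mult; simpl. ring.
    + intros t _. rewrite (is_derive_unique (fun u : R => gauss_aux u t) _ _
      (is_derive_gauss_aux x t)).
      unfold scal; simpl; unfold mult; simpl. unfold gauss.
      replace (exp (- (x * (x * 1) * (1 + t * (t * 1)) / 2))) with
        (exp (- (x ^ 2 / 2)) * exp (- ((x * t + 0) ^ 2 / 2))).
      ring. rewrite <- exp_plus. f_equal. simpl. field.
Qed.

(** The left-hand side has derivative 0, and at x = 0 only the integral of
    2 / (1 + t^2) over [0, 1] is left. *)
Lemma gauss_int_sqr x : gauss_int x ^ 2 + 2 * RInt (gauss_aux x) 0 1 = PI / 2.
Proof.
  set (f := fun x => gauss_int x ^ 2 + 2 * RInt (gauss_aux x) 0 1).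
  assert (Hd : forall t, is_derive f t 0).
  { intros t.
    replace 0 with (plus (2 * (gauss t * gauss_int t)) (2 * - (gauss t * gauss_int t)))
      by (unfold plus; simpl; ring).
    unfold f.
    apply (is_derive_plus (K:=R_AbsRing) (V:=R_NormedModule)).
    - auto_derive. eexists; apply is_derive_gauss_int.
      rewrite (is_derive_unique (fun x : R => gauss_int x) _ _ (is_derive_gauss_int t)).
      ring.
    - apply (is_derive_scal
        (fun x => RInt (gauss_aux x) 0 1) t 2). 
      apply is_derive_gauss_aux_int. }
  assert (H0 : f 0 = PI / 2).
  { unfold f, gauss_int. rewrite RInt_point.
    replace (RInt (gauss_aux 0) 0 1) with (PI / 4).
    unfold zero; simpl; field.
    symmetry. apply is_RInt_unique.
    apply is_RInt_ext with (fun t => / (1 + t²)).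
    { intros t _. unfold gauss_aux, Rsqr. 
      replace (- (0 ^ 2 * (1 + t ^ 2) / 2)) with 0 by field. rewrite exp_0. match goal with
        |- ?a = ?b => change (@eq R a b) end. field. nra. }
    replace (PI / 4) with (minus (atan 1) (atan 0))
      by (rewrite atan_1, atan_0; unfold minus, plus, opp; simpl; ring).
    apply (is_RInt_derive (V := R_CompleteNormedModule) atan).
    - intros; apply is_derive_atan.
    - intros t _. apply ex_derive_continuous_R.
      unfold Rsqr. auto_derive. nra. }
  change (f x = PI / 2). rewrite <- H0.
  destruct (Rtotal_order x 0) as [H|[->|H]]; [|reflexivity|].
  - apply (eq_is_derive (V := R_NormedModule) f x 0); [intros; apply Hd|exact H].
  - symmetry. apply (eq_is_derive (V := R_NormedModule) f 0 x); [intros; apply Hd|exact H].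
Qed.

Lemma gauss_aux_int_bounds x : 0 <= RInt (gauss_aux x) 0 1 <= gauss x.
Proof.
  split.
  - apply RInt_ge_0. lra. apply ex_RInt_gauss_aux.
    intros t _. unfold gauss_aux. apply Rdiv_le_0_compat. left; apply exp_pos. nra.
  - replace (gauss x) with (RInt (fun _ => gauss x) 0 1).
    2: { rewrite RInt_const. unfold scal; simpl; unfold mult; simpl. ring. }
    apply RInt_le. lra. apply ex_RInt_gauss_aux. apply ex_RInt_const.
    intros t _. unfold gauss_aux, gauss.
    assert (H := exp_pos (- (x ^ 2 * (1 + t ^ 2) / 2))).
    apply Rle_trans with (exp (- (x ^ 2 * (1 + t ^ 2) / 2))).
    + apply Rmult_le_reg_r with (1 + t ^ 2). nra.
      unfold Rdiv at 1. rewrite Rmult_assoc, Rinv_l by nra. nra.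
    + apply exp_le. assert (0 <= x ^ 2 * t ^ 2) by (rewrite <- Rpow_mult_distr;
      apply pow2_ge_0). nra.
Qed.

Lemma gauss_le s : gauss s <= 4 / (1 + s ^ 2).
Proof.
  generalize (exp_quadratic_le 0 0 s). unfold gauss.
  replace (0 + 0 * Rabs s - s ^ 2 / 2) with (- (s ^ 2 / 2)) by field.
  replace (0 + 0 ^ 2) with 0 by ring. rewrite exp_0, Rmult_1_r. trivial.
Qed.

Lemma gauss_int_opp x : gauss_int (- x) = - gauss_int x.
Proof.
  unfold gauss_int.
  assert (H := RInt_comp_lin (V :=
    R_CompleteNormedModule) gauss (-1) 0 0 x (ex_RInt_gauss _ _)).
  replace (-1 * 0 + 0) with 0 in H by ring. replace (-1 * x + 0) with (- x) in H by ring.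
  rewrite <- H. rewrite (RInt_scal (V := R_CompleteNormedModule)).
  - rewrite (RInt_ext _ gauss). unfold scal; simpl; unfold mult; simpl; ring.
    intros t _. unfold gauss. do 3 f_equal. ring.
  - apply ex_RInt_ext with gauss. 2: apply ex_RInt_gauss.
    intros t _. unfold gauss. do 3 f_equal. ring.
Qed.

Lemma is_RInt_gen_gauss :
  is_RInt_gen gauss (Rbar_locally m_infty) (Rbar_locally p_infty) (sqrt (2 * PI)).
Proof.
  assert (HP := PI_RGT_0).
  set (c := sqrt (PI / 2)).
  assert (Hc : 0 < c) by (apply sqrt_lt_R0; lra).
  assert (Hcc : c * c = PI / 2) by (apply sqrt_sqrt; lra).
  replace (sqrt (2 * PI)) with (c - - c).
  2: { replace (2 * PI) with ((c - - c)²) by (unfold Rsqr; nra). rewrite sqrt_Rsqr; lra. }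
  destruct (dominated_tendsto_0 (fun x => gauss_int (Rabs x) - c) (8 / c)) as [L1 L2].
  { intros s. replace (1 + s ^ 2) with (1 + Rabs s ^ 2) by (rewrite pow2_abs; ring).
    generalize (Rabs s) (Rabs_pos s). clear s. intros s Hs.
    assert (Hg : 0 <= gauss_int s).
    { unfold gauss_int. apply RInt_ge_0; trivial. apply ex_RInt_gauss.
      intros; left; apply exp_pos. }
    generalize (gauss_int_sqr s) (gauss_aux_int_bounds s) (gauss_le s). intros H1 H2 H3.
    assert (H4 : Rabs (gauss_int s - c) * c <= 2 * (4 / (1 + s ^ 2))).
    { apply Rle_trans with (Rabs (gauss_int s - c) * (gauss_int s + c)).
      - apply Rmult_le_compat_l. apply Rabs_pos. lra.
      - rewrite <- (Rabs_right (gauss_int s + c)) by lra. rewrite <- Rabs_mult.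
        replace ((gauss_int s - c) * (gauss_int s + c)) with
          (- (2 * RInt (gauss_aux s) 0 1)) by nra.
        rewrite Rabs_Ropp, Rabs_right; lra. }
    apply Rmult_le_reg_r with c; trivial.
    apply Rle_trans with (1 := H4). right. field. nra. }
  apply is_RInt_gen_primitive with gauss_int.
  - apply is_derive_gauss_int.
  - apply continuous_gauss.
  - intros P [e He]. destruct (L1 (ball 0 e)) as [M HM]. now exists e.
    exists (Rmin M 0). intros x Hx. apply He.
    assert (Hx0 : x < 0) by (apply Rlt_le_trans with (1 := Hx); apply Rmin_r).
    specialize (HM x ltac:(apply Rlt_le_trans with (1 := Hx); apply Rmin_l)).
    change (Rabs (gauss_int (Rabs x) - c - 0) < e) in HM.
    change (Rabs (gauss_int x - - c) < e).
    rewrite (Rabs_left x), gauss_int_opp in HM by trivial.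
    rewrite <- Rabs_Ropp. replace (- (gauss_int x - - c)) with (- gauss_int x - c - 0) by
      ring. trivial.
  - intros P [e He]. destruct (L2 (ball 0 e)) as [M HM]. now exists e.
    exists (Rmax M 0). intros x Hx. apply He.
    assert (Hx0 : 0 < x) by (apply Rle_lt_trans with (2 := Hx); apply Rmax_r).
    specialize (HM x ltac:(apply Rle_lt_trans with (2 := Hx); apply Rmax_l)).
    change (Rabs (gauss_int (Rabs x) - c - 0) < e) in HM.
    change (Rabs (gauss_int x - c) < e).
    rewrite (Rabs_right x) in HM by lra.
    replace (gauss_int x - c) with (gauss_int x - c - 0) by ring. trivial.
Qed.

Lemma int_line_gauss : int_line (fun s => RtoC (gauss s)) (RtoC (sqrt (2 * PI))).
Proof.
  apply int_line_parts. split.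
  - exact is_RInt_gen_gauss.
  - simpl. replace 0 with (scal 0 (sqrt (2 * PI))) by (unfold scal; simpl; unfold mult;
    simpl; ring).
    apply (is_RInt_gen_ext (V := R_NormedModule) (fun s => scal 0 (gauss s))).
    + apply filter_forall. intros ab s _. unfold scal; simpl; unfold mult; simpl; ring.
    + apply (is_RInt_gen_scal (V := R_NormedModule)). apply is_RInt_gen_gauss.
Qed.

Open Scope C_scope.

(** * Recessive solutions of the parabolic cylinder equation *)

(** The equation y'' = (z^2/4 + a) y as a first-order system with y1 = y'. Derivatives
    along lines are all that the uniqueness argument uses. *)
Record solution (a : C) (y y1 : C -> C) : Prop := {
  solution_derive : forall (z d : C) (x : R),
    path_derive (fun s => y (z + s * d)) x (d * y1 (z + x * d));
  solution_derive' : forall (z d : C) (x : R), path_derive (fun s => y1 (z + s * d)) x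
    (d * (((z + x * d) * (z + x * d) / 4 + a) * y (z + x * d)))
}.

(** The function x^(-al) exp (-x^2/4) on the positive real axis. *)
Definition recessive_model (al : C) (x : R) : C := Cexp (- (al * Clog_right x) - x * x / 4).

Definition recessive_asymptotic (al : C) (y : C -> C) : Prop :=
  forall eps : R, (0 < eps)%R -> exists M : R, forall x : R, (M < x)%R ->
  (Cmod (y x / recessive_model al x - 1) < eps)%R.

Lemma solution_comb a y y1 v v1 c : solution a y y1 -> solution a v v1 ->
  solution a (fun z => y z - c * v z) (fun z => y1 z - c * v1 z).
Proof.
  intros [H1 H2] [H3 H4]; split; intros z d x.
  - eapply path_derive_eq. apply path_derive_minus. apply H1. apply path_derive_scal.
    apply H3. ring.
  - eapply path_derive_eq. apply path_derive_minus. apply H2. apply path_derive_scal.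
    apply H4. cbv beta. ring.
Qed.

(** The left-hand side is the real scalar product of u and c v: apply the
    Cauchy-Schwarz inequality and then |u||v| <= (|u|^2 + |v|^2)/2. *)
Lemma Re_sqr_conj_le (u v c : C) M :
  (Cmod c <= M)%R ->
  (Re u * Re (c * v) + Im u * Im (c * v) <= M * (Cmod u * Cmod u + Cmod v * Cmod v) / 2)%R.
Proof.
  intros Hc.
  apply Rle_trans with (Cmod u * Cmod (c * v))%R.
  - apply Rsqr_incr_0_var.
    + unfold Rsqr.
      replace (Cmod u * Cmod (c * v) * (Cmod u * Cmod (c * v)))%R with
        ((Cmod u * Cmod u) * (Cmod (c * v) * Cmod (c * v)))%R by ring.
      rewrite !Cmod_sqr. generalize (c * v). intros w.
      assert (0 <= (Re u * Im w - Im u * Re w) ^ 2)%R by apply pow2_ge_0. nra.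
    + apply Rmult_le_pos; apply Cmod_ge_0.
  - rewrite Cmod_mult. assert (Hu := Cmod_ge_0 u). assert (Hv := Cmod_ge_0 v).
    assert (H0 := Cmod_ge_0 c).
    apply Rle_trans with (M * (Cmod u * Cmod v))%R.
    + replace (Cmod u * (Cmod c * Cmod v))%R with (Cmod c * (Cmod u * Cmod v))%R by ring.
      apply Rmult_le_compat_r; trivial. now apply Rmult_le_pos.
    + assert (0 <= (Cmod u - Cmod v) ^ 2)%R by apply pow2_ge_0. nra.
Qed.

Lemma is_derive_normsqr f x l : path_derive f x l ->
  is_derive (fun s => Cmod (f s) * Cmod (f s))%R x (2 * (Re (f x) * Re l + Im (f x) * Im
    l))%R.
Proof.
  intros [H1 H2].
  assert (G : forall (u v : R -> R) (u' v' : R), is_derive u x u' -> is_derive v x v' ->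
    is_derive (fun s => u s * u s + v s * v s)%R x (2 * (u x * u' + v x * v'))%R).
  { clear. intros u v u' v' Hu Hv. auto_derive. 
    - repeat split; eexists; eassumption.
    - rewrite (is_derive_unique (fun s : R => u s) _ _ Hu),
       (is_derive_unique (fun s : R => v s) _ _ Hv). ring. }
  eapply is_derive_ext; [|exact (G _ _ _ _ H1 H2)].
  intros s. symmetry. apply Cmod_sqr.
Qed.

Lemma is_derive_damped (N : R -> R) (s n L : R) : is_derive N s n ->
  is_derive (fun s => N s * exp (- (L * s)))%R s ((n - L * N s) * exp (- (L * s)))%R.
Proof.
  intros H. auto_derive. eexists; apply H.
  rewrite (is_derive_unique (fun s : R => N s) _ _ H). ring.
Qed.

(** Uniqueness for the initial value problem by an energy estimate: along the segment
    from z0 to z the energy N = |y|^2 + |y1|^2 satisfies N' <= L N and starts at 0, so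
    N exp (-L s) stays at 0. *)
Lemma solution_zero a y y1 z0 : solution a y y1 -> y z0 = 0 -> y1 z0 = 0 ->
  forall z, y z = 0.
Proof.
  intros [H1 H2] E0 E1 z.
  set (d := z - z0).
  set (q := fun s : R => (z0 + s * d) * (z0 + s * d) / 4 + a).
  set (Q := ((Cmod z0 + Cmod d) ^ 2 + Cmod a)%R).
  set (L := (Cmod d * (1 + Q))%R).
  set (f := fun s : R => y (z0 + s * d)). set (g := fun s : R => y1 (z0 + s * d)).
  set (N := fun s => (Cmod (f s) * Cmod (f s) + Cmod (g s) * Cmod (g s))%R).
  set (N' := fun s => (2 * (Re (f s) * Re (d * g s) + Im (f s) * Im (d * g s)) +
     2 * (Re (g s) * Re (d * (q s * f s)) + Im (g s) * Im (d * (q s * f s))))%R).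
  assert (HN : forall s, is_derive N s (N' s)).
  { intros s. apply (is_derive_plus (K:=R_AbsRing) (V:=R_NormedModule)
      (fun s => Cmod (f s) * Cmod (f s))%R (fun s => Cmod (g s) * Cmod (g s))%R);
    apply is_derive_normsqr; [apply H1 | apply H2]. }
  assert (Hd := Cmod_ge_0 d). assert (Hz0 := Cmod_ge_0 z0). assert (Ha := Cmod_ge_0 a).
  assert (HN0 : forall s, (0 <= N s)%R).
  { intros s. unfold N. nra. }
  assert (HQ : forall s, (0 <= s <= 1)%R -> (Cmod (q s) <= Q)%R).
  { intros s Hs. unfold q, Q. apply Rle_trans with (1 := Cmod_triangle _ _).
    apply Rplus_le_compat_r.
    assert (Hm : (Cmod (z0 + s * d) <= Cmod z0 + Cmod d)%R).
    { apply Rle_trans with (1 := Cmod_triangle _ _). apply Rplus_le_compat_l.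
      rewrite Cmod_mult, Cmod_R, Rabs_right by lra. nra. }
    rewrite Cmod_div by (apply RtoC_neq_0; lra).
    rewrite Cmod_mult, Cmod_R, Rabs_right by lra.
    assert (Hm0 := Cmod_ge_0 (z0 + s * d)). nra. }
  (* Both cross terms of N' are at most a constant times |f||g|, hence times N. *)
  assert (HNL : forall s, (0 <= s <= 1)%R -> (N' s <= L * N s)%R).
  { intros s Hs. unfold N', N, L.
    assert (A1 := Re_sqr_conj_le (f s) (g s) d (Cmod d) (Rle_refl _)).
    assert (A2 := Re_sqr_conj_le (g s) (f s) (d * q s) (Cmod d * Q)).
    rewrite Cmult_assoc.
    assert (Hdq : (Cmod (d * q s) <= Cmod d * Q)%R).
    { rewrite Cmod_mult. apply Rmult_le_compat_l; trivial. now apply HQ. }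
    specialize (A2 Hdq). lra. }
  destruct (MVT_gen (fun s => N s * exp (- (L * s)))%R 0 1
    (fun s => (N' s - L * N s) * exp (- (L * s)))%R) as [c [Hc Ec]].
  - intros s _. apply is_derive_damped, HN.
  - intros s _. apply continuity_pt_filterlim.
    apply (ex_derive_continuous_R (fun s => N s * exp (- (L * s)))%R).
    eexists. apply is_derive_damped, HN.
  - rewrite Rmin_left, Rmax_right in Hc by lra.
    assert (HNc := HNL c Hc).
    assert (Hec := exp_pos (- (L * c))). assert (He1 := exp_pos (- (L * 1))).
    assert (N0 : N 0%R = 0%R).
    { unfold N, f, g. replace (z0 + 0%R * d) with z0 by ring. rewrite E0, E1, Cmod_0. ring.
      }
    rewrite N0 in Ec.
    assert (HN1 := HN0 1%R).
    assert (HNe : (N 1 * exp (- (L * 1)) <= 0)%R) by nra.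
    assert (N1 : (N 1 <= 0)%R) by nra.
    assert (Hf : (Cmod (f 1%R) * Cmod (f 1%R) <= 0)%R) by (unfold N in N1; nra).
    apply Cmod_eq_0. replace z with (z0 + 1%R * d) by (unfold d; ring).
    fold (f 1%R). generalize (Cmod_ge_0 (f 1%R)). nra.
Qed.

Lemma recessive_model_bound al (x : R) : (1 <= x)%R ->
  (Cmod (recessive_model al x) <= exp (Cmod al * x - x ^ 2 / 4))%R.
Proof.
  intros Hx. unfold recessive_model. rewrite Cmod_Cexp, Clog_right_R by lra. apply exp_le.
  rewrite Re_minus, Re_div4, Re_opp. 
  replace (Re (x * x)) with (x ^ 2)%R by (partsr; ring).
  assert (H := Re_prod_le al (ln x)).
  rewrite Cmod_R in H.
  assert (Hl : (0 <= ln x)%R) by (rewrite <- ln_1; apply ln_le; lra).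
  rewrite (Rabs_right (ln x)) in H by lra.
  assert (Hl2 := ln_le_self x ltac:(lra)).
  assert (Ha := Cmod_ge_0 al).
  apply Rabs_le_between in H. nra.
Qed.

Lemma recessive_model_neq_0 al x : recessive_model al x <> 0.
Proof. apply Cexp_neq_0. Qed.

Lemma wronskian_constant a y y1 v v1 (x : R) : solution a y y1 -> solution a v v1 ->
  y x * v1 x - y1 x * v x = y 0 * v1 0 - y1 0 * v 0.
Proof.
  intros [H1 H2] [H3 H4].
  set (W := fun s : R => y (0 + s * 1) * v1 (0 + s * 1) - y1 (0 + s * 1) * v (0 + s * 1)).
  assert (H : (Cmod (W x - W 0%R) <= 2 * 0 * Rabs (x - 0))%R).
  { apply mean_value_ineq with (fun _ => RtoC 0).
    - intros s _. eapply path_derive_eq. apply path_derive_minus; apply path_derive_mult.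
      apply H1. apply H4. apply H2. apply H3. cbv beta. ring.
    - intros. rewrite Cmod_0. lra. }
  apply Ceq_minus. apply Cmod_eq_0.
  replace (y x * v1 x - y1 x * v x - (y 0 * v1 0 - y1 0 * v 0)) with (W x - W 0%R).
  - generalize (Cmod_ge_0 (W x - W 0%R)). lra.
  - unfold W. replace (0 + x * 1) with (RtoC x) by ring. replace (0 + 0%R * 1) with
    (RtoC 0) by ring.
    reflexivity.
Qed.

(** The asymptotic hypothesis says nothing about y1. The equation carries the decay
    over to the second derivative, and a first-order Taylor expansion on [x, x + 1]
    then carries it to y1. *)
Lemma solution_decay a al y y1 : solution a y y1 -> recessive_asymptotic al y ->
  exists C M, forall x : R, (M < x)%R ->
    (Cmod (y x) <= C * exp (- x))%R /\ (Cmod (y1 x) <= C * exp (- x))%R.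
Proof.
  intros [H1 H2] Hy.
  destruct (Hy 1%R Rlt_0_1) as [M0 HM0].
  set (A := Cmod al). assert (HA : (0 <= A)%R) by apply Cmod_ge_0.
  assert (Ha := Cmod_ge_0 a).
  (* The exponent A x - x^2/4 + x is at most (A + 2)^2 - x; the extra term x
     pays for the polynomial coefficient x^2/4 + a. *)
  set (C1 := (2 * (1 + Cmod a) * exp ((A + 2) ^ 2))%R).
  assert (HC1 : (0 < C1)%R). { unfold C1. generalize (exp_pos ((A + 2) ^ 2)). nra. }
  assert (G : forall x : R, (Rmax M0 1 < x)%R ->
     (Cmod (y x) <= C1 * exp (- x))%R /\
     (Cmod ((x * x / 4 + a) * y x) <= C1 * exp (- x))%R).
  { intros x Hx.
    assert (HxM : (M0 < x)%R) by (apply Rle_lt_trans with (2 := Hx); apply Rmax_l).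
    assert (Hx1 : (1 < x)%R) by (apply Rle_lt_trans with (2 := Hx); apply Rmax_r).
    assert (Hm := recessive_model_bound al x ltac:(lra)).
    assert (Hyx : (Cmod (y x) <= 2 * Cmod (recessive_model al x))%R).
    { replace (y x) with ((y x / recessive_model al x - 1 + 1) * recessive_model al x)
        by (field; apply recessive_model_neq_0).
      rewrite Cmod_mult. apply Rmult_le_compat_r. apply Cmod_ge_0.
      apply Rle_trans with (1 := Cmod_triangle _ _). rewrite Cmod_1.
      generalize (HM0 x HxM). lra. }
    assert (Hq : (Cmod (x * x / 4 + a) <= (1 + Cmod a) * exp x)%R).
    { apply Rle_trans with (1 := Cmod_triangle _ _).
      rewrite Cmod_div by (apply RtoC_neq_0; lra). rewrite Cmod_mult, !Cmod_R,
        !Rabs_right by lra.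
      assert (He := exp_ineq1_le (x / 2)).
      assert (E2 : exp x = (exp (x / 2) * exp (x / 2))%R).
      { rewrite <- exp_plus. f_equal. field. }
      assert (He2 : (1 + x * x / 4 <= exp x)%R) by (rewrite E2; nra).
      assert (0 <= Cmod a * (exp x - 1))%R by (apply Rmult_le_pos; nra).
      lra. }
    assert (He : (exp x * exp (A * x - x ^ 2 / 4) <= exp ((A + 2) ^ 2) * exp (- x))%R).
    { rewrite <- !exp_plus. apply exp_le.
      assert (0 <= (x / 2 - (A + 2)) ^ 2)%R by apply pow2_ge_0. nra. }
    assert (Hex : (1 <= exp x)%R) by (generalize (exp_ineq1_le x); lra).
    fold A in Hm.
    assert (Hm0 := Cmod_ge_0 (recessive_model al x)).
    assert (HK : (exp x * Cmod (recessive_model al x) <= exp ((A + 2) ^ 2) * exp (- x))%R).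
    { apply Rle_trans with (2 := He). apply Rmult_le_compat_l; lra. }
    split.
    - apply Rle_trans with (1 := Hyx). unfold C1.
      assert (Cmod (recessive_model al x) <= exp x * Cmod (recessive_model al x))%R by nra.
      assert (0 <= exp ((A + 2) ^ 2) * exp (- x))%R
        by (apply Rmult_le_pos; left; apply exp_pos).
      nra.
    - rewrite Cmod_mult. unfold C1.
      apply Rle_trans with ((1 + Cmod a) * exp x * (2 * Cmod (recessive_model al x)))%R.
      + apply Rmult_le_compat; trivial; apply Cmod_ge_0.
      + replace (2 * (1 + Cmod a) * exp ((A + 2) ^ 2) * exp (- x))%R with
         (2 * (1 + Cmod a) * (exp ((A + 2) ^ 2) * exp (- x)))%R by ring.
        replace ((1 + Cmod a) * exp x * (2 * Cmod (recessive_model al x)))%R with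
         (2 * (1 + Cmod a) * (exp x * Cmod (recessive_model al x)))%R by ring.
        apply Rmult_le_compat_l; lra. }
  exists (6 * C1)%R, (Rmax M0 1). intros x Hx.
  assert (Hep := exp_pos (- x)).
  destruct (G x Hx) as [G1 _].
  split. nra.
  (* y' (x) is y (x + 1) - y (x) up to the second-order remainder on [x, x + 1]. *)
  assert (T := taylor_order2_ineq (fun s => y (x + s * 1)) (fun s => 1 * y1 (x + s * 1))
    (fun s => 1 * (1 * (((x + s * 1) * (x + s * 1) / 4 + a) * y (x + s * 1))))
    (C1 * exp (- x))).
  assert (Tx : forall s : R, x + s * 1 = RtoC (x + s)) by (intros; rewrite RtoC_plus; ring).
  cbv beta in T.
  specialize (T ltac:(intros; apply H1) ltac:(intros; apply path_derive_scal, H2)).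
  assert (Hmon : forall s, (0 <= s)%R -> (exp (- (x + s)) <= exp (- x))%R).
  { intros s Hs. apply exp_le. lra. }
  lapply T; clear T.
  2: { intros s Hs. rewrite !Cmult_1_l, Tx.
    apply Rle_trans with (1 := proj2 (G (x + s)%R ltac:(lra))).
    apply Rmult_le_compat_l. lra. apply Hmon. lra. }
  intros T'.
  rewrite !Tx, Cmult_1_l, Rplus_0_r in T'.
  assert (G2 := proj1 (G (x + 1)%R ltac:(lra))).
  assert (G3 := Hmon 1%R ltac:(lra)).
  replace (y1 x) with ((y (x + 1)%R - y x) - (y (x + 1)%R - y x - y1 x)) by ring.
  apply Rle_trans with (1 := Cmod_triang_minus _ _).
  assert (G4 := Cmod_triang_minus (y (x + 1)%R) (y x)).
  nra.
Qed.

(** The Wronskian is constant and, by [solution_decay], tends to 0 at infinity. *)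
Lemma wronskian_zero a al y y1 v v1 (x : R) : solution a y y1 -> solution a v v1 ->
  recessive_asymptotic al y -> recessive_asymptotic al v -> y x * v1 x - y1 x * v x = 0.
Proof.
  intros Sy Sv Ay Av. rewrite (wronskian_constant a y y1 v v1 x) by assumption.
  destruct (solution_decay a al y y1 Sy Ay) as [A [M HM]].
  destruct (solution_decay a al v v1 Sv Av) as [B [L HL]].
  set (w := y 0 * v1 0 - y1 0 * v 0).
  apply Cmod_eq_0. destruct (Rle_lt_or_eq_dec _ _ (Cmod_ge_0 w)) as [Hw|Hw];
    [|now symmetry].
  exfalso.
  set (t := (1 + Rmax 0 (Rmax M (Rmax L (2 * A * B / Cmod w))))%R).
  assert (T0 : (0 < t)%R) by (generalize (Rmax_l 0 (Rmax M (Rmax L (2 * A * B / Cmod w))));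
    unfold t; lra).
  assert (T1 : (Rmax M (Rmax L (2 * A * B / Cmod w)) < t)%R)
    by (generalize (Rmax_r 0 (Rmax M (Rmax L (2 * A * B / Cmod w)))); unfold t; lra).
  assert (T2 : (M < t)%R) by (apply Rle_lt_trans with (2 := T1); apply Rmax_l).
  assert (T3 : (Rmax L (2 * A * B / Cmod w) < t)%R) by (apply Rle_lt_trans with (2 := T1);
    apply Rmax_r).
  assert (T4 : (L < t)%R) by (apply Rle_lt_trans with (2 := T3); apply Rmax_l).
  assert (T5 : (2 * A * B / Cmod w < t)%R) by (apply Rle_lt_trans with (2 := T3);
    apply Rmax_r).
  destruct (HM t T2) as [M1 M2]. destruct (HL t T4) as [L1 L2].
  assert (Ew : w = y t * v1 t - y1 t * v t).
  { symmetry. now apply wronskian_constant with a. }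
  assert (Bw : (Cmod w <= 2 * A * B * (exp (- t) * exp (- t)))%R).
  { rewrite Ew. apply Rle_trans with (1 := Cmod_triang_minus _ _). rewrite !Cmod_mult.
    assert (P1 := Cmod_ge_0 (y t)). assert (P2 := Cmod_ge_0 (y1 t)).
    assert (P3 := Cmod_ge_0 (v t)). assert (P4 := Cmod_ge_0 (v1 t)).
    assert (Q1 : (Cmod (y t) * Cmod (v1 t) <= A * exp (- t) * (B * exp (- t)))%R)
      by now apply Rmult_le_compat.
    assert (Q2 : (Cmod (y1 t) * Cmod (v t) <= A * exp (- t) * (B * exp (- t)))%R)
      by now apply Rmult_le_compat.
    lra. }
  assert (Et : (exp (- t) * exp (- t) * t <= 1)%R).
  { rewrite exp_Ropp. assert (He := exp_ineq1_le t). 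
    assert (Hi : (/ exp t <= 1)%R) by (rewrite <- Rinv_1; apply Rinv_le_contravar; lra).
    assert (Hi0 : (0 < / exp t)%R) by (apply Rinv_0_lt_compat; lra).
    assert (Hit : (/ exp t * t <= 1)%R).
    { apply Rmult_le_reg_l with (exp t). lra. rewrite <- Rmult_assoc, Rinv_r; lra. }
    nra. }
  assert (T6 : (2 * A * B < Cmod w * t)%R).
  { apply Rmult_lt_reg_r with (/ Cmod w)%R. now apply Rinv_0_lt_compat.
    replace (Cmod w * t * / Cmod w)%R with t by (field; lra). exact T5. }
  assert (Ep : (0 < exp (- t) * exp (- t))%R) by (apply Rmult_lt_0_compat; apply exp_pos).
  nra.
Qed.

(** A vanishing Wronskian makes the solutions proportional, and the common asymptotic
    model makes the factor 1. *)
Lemma recessive_unique a al y y1 v v1 : solution a y y1 -> solution a v v1 ->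
  recessive_asymptotic al y -> recessive_asymptotic al v -> forall z, y z = v z.
Proof.
  intros Sy Sv Ay Av.
  destruct (Av 1%R Rlt_0_1) as [M HM].
  set (x0 := (M + 1)%R).
  assert (Hv : v x0 <> 0).
  { intros E. generalize (HM x0 ltac:(unfold x0; lra)). rewrite E.
    replace (0 / recessive_model al x0 - 1) with (- (1)) by (field;
      apply recessive_model_neq_0).
    rewrite Cmod_opp, Cmod_1. lra. }
  (* y - c v vanishes at x0, and so does its derivative since the Wronskian is 0. *)
  set (c := y x0 / v x0).
  assert (HD : forall z, y z - c * v z = 0).
  { apply (solution_zero a (fun z => y z - c * v z) (fun z => y1 z - c * v1 z) x0).
    - now apply solution_comb.
    - unfold c. field. exact Hv.
    - unfold c. 
      replace (y1 x0 - y x0 / v x0 * v1 x0) with (- (y x0 * v1 x0 - y1 x0 * v x0) / v x0)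
        by (field; exact Hv).
      rewrite (wronskian_zero a al y y1 v v1 x0) by assumption. field. exact Hv. }
  assert (Hc : c - 1 = 0).
  { apply Cmod_eq_0. apply Rle_antisym. 2: apply Cmod_ge_0.
    apply le_epsilon. intros e He. rewrite Rplus_0_l.
    set (e' := (e / (2 + Cmod c))%R).
    assert (Hcp := Cmod_ge_0 c).
    assert (He' : (0 < e')%R) by (apply Rdiv_lt_0_compat; lra).
    destruct (Ay e' He') as [M1 HM1]. destruct (Av e' He') as [M2 HM2].
    set (x := (1 + Rmax M1 M2)%R).
    assert (X1 := HM1 x ltac:(generalize (Rmax_l M1 M2); unfold x; lra)).
    assert (X2 := HM2 x ltac:(generalize (Rmax_r M1 M2); unfold x; lra)).
    replace (c - 1) with ((y x / recessive_model al x - 1) - c * (v x / recessive_model al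
      x - 1)).
    2: { replace (y x) with (c * v x). field. apply recessive_model_neq_0.
         symmetry. apply Ceq_minus. apply HD. }
    apply Rle_trans with (1 := Cmod_triang_minus _ _). rewrite Cmod_mult.
    assert (Ee : e = (e' * (2 + Cmod c))%R) by (unfold e'; field; lra).
    nra. }
  intros z. apply Ceq_minus. rewrite <- (HD z).
  replace c with (RtoC 1). ring. symmetry. now apply Ceq_minus.
Qed.

(** * The line integral as the recessive solution *)

Definition norm_const : C := RtoC (sqrt (2 * PI)).

Lemma norm_const_pos : (0 < sqrt (2 * PI))%R.
Proof. apply sqrt_lt_R0. generalize PI_RGT_0. lra. Qed.

Lemma norm_const_neq_0 : norm_const <> 0.
Proof. apply RtoC_neq_0. generalize norm_const_pos. lra. Qed.

(** Any abscissa Re p > 0 gives the same function; p = 1 is a choice. *)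
Definition pcU_integral (al z : C) : C :=
  / norm_const * (Cexp (z * z / 4) * line_integral al z 1).
Definition pcU_integral' (al z : C) : C :=
  / norm_const * (Cexp (z * z / 4) * (z / 2 * line_integral al z 1 - line_integral (al - 1)
    z 1)).

Lemma path_derive_exp_sqr (z d : C) x :
  path_derive (fun s => Cexp ((z + s * d) * (z + s * d) / 4)) x
    (d * ((z + x * d) / 2) * Cexp ((z + x * d) * (z + x * d) / 4)).
Proof.
  eapply path_derive_eq.
  - apply path_derive_Cexp. apply path_derive_mult; [|apply path_derive_const].
    apply path_derive_mult; apply path_derive_line.
  - cbv beta. field.
Qed.

(** Differentiating twice in z produces the line integrals with parameters al, al - 1
    and al - 2; the equation is the recurrence between them. *)
Lemma pcU_integral_solution al : solution (al - 1 / 2) (pcU_integral al) (pcU_integral' al).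
Proof.
  assert (H1 : (0 < Re 1)%R) by (simpl; lra).
  split; intros z d x.
  - eapply path_derive_eq.
    + apply path_derive_scal. apply path_derive_mult. apply path_derive_exp_sqr.
      apply path_derive_line_integral_z; trivial.
    + cbv beta. unfold pcU_integral'. field. exact norm_const_neq_0.
  - eapply path_derive_eq.
    + apply path_derive_scal. apply path_derive_mult. apply path_derive_exp_sqr.
      apply path_derive_minus; [|apply path_derive_line_integral_z; trivial].
      apply path_derive_mult; [|apply path_derive_line_integral_z; trivial].
      apply path_derive_mult; [apply path_derive_line | apply path_derive_const].
    + cbv beta. unfold pcU_integral.
      assert (HK := line_integral_recurrence (al - 1) (z + x * d) 1 H1).
      replace (al - 1 + 1) with al in HK by ring.
      set (w := z + x * d) in *.
      assert (E2 : line_integral (al - 1 - 1) w 1 = w * line_integral (al - 1) w 1 + (al -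
        1) * line_integral al w 1).
      { apply Ceq_minus. rewrite <- HK. ring. }
      rewrite E2. field. exact norm_const_neq_0.
Qed.

(** |x + i s| lies between x and x + |s|, which is at most x exp |s| as x >= 1. *)
Lemma ln_ratio_bound (x s : R) : (1 <= x)%R ->
  (Rabs (ln (Cmod (x + s * Ci)) - ln x) <= Rabs s)%R.
Proof.
  intros Hx.
  assert (H1 : (x <= Cmod (x + s * Ci))%R).
  { apply Rle_trans with (2 := re_le_Cmod _). rewrite Re_vertical. apply Rle_abs. }
  assert (H2 : (Cmod (x + s * Ci) <= x + Rabs s)%R).
  { apply Rle_trans with (1 := Cmod_triangle _ _).
    rewrite Cmod_mult, !Cmod_R, Cmod_Ci, (Rabs_right x) by lra. lra. }
  assert (H3 := ln_le x (Cmod (x + s * Ci)) ltac:(lra) H1).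
  rewrite Rabs_right by lra.
  assert (Hs := Rabs_pos s).
  assert (H4 : (ln (Cmod (x + s * Ci)) <= ln (x * exp (Rabs s)))%R).
  { apply ln_le. lra. apply Rle_trans with (1 := H2).
    generalize (exp_ineq1_le (Rabs s)). nra. }
  rewrite ln_mult, ln_exp in H4; [lra | lra | apply exp_pos].
Qed.

Lemma power_ratio_bound al (x s : R) : (1 <= x)%R ->
  (Cmod (Cexp (- (al * (Clog_right (x + s * Ci) - Clog_right x)))) <= exp (Cmod al * (Rabs
    s + PI)))%R.
Proof.
  intros Hx. rewrite Cmod_Cexp. apply exp_le. rewrite Re_opp.
  assert (H := Re_prod_le al (Clog_right (x + s * Ci) - Clog_right x)).
  apply Rabs_le_between in H.
  assert (Hm : (Cmod (Clog_right (x + s * Ci) - Clog_right x) <= Rabs s + PI)%R).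
  { apply Rle_trans with (1 := Cmod_le_parts _). rewrite (Clog_right_R x) by lra.
    apply Rplus_le_compat.
    - now apply ln_ratio_bound.
    - rewrite Im_minus, Im_R, Rminus_0_r.
      generalize (Im_Clog_right_bound (x + s * Ci)) PI_RGT_0. intros. apply Rabs_le. lra. }
  generalize (Rmult_le_compat_l _ _ _ (Cmod_ge_0 al) Hm). lra.
Qed.

(** The factor ((x + i s) / x)^(-al) equals 1 at s = 0 and its derivative along the
    segment to s carries 1 / x; the growth in |s| is left to the Gaussian. *)
Lemma power_ratio_near_1 al (x s : R) : (1 <= x)%R ->
  (Cmod (Cexp (- (al * (Clog_right (x + s * Ci) - Clog_right x))) - 1) <=
    2 * Cmod al / x * exp (Cmod al * PI + (Cmod al + 1) * Rabs s))%R.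
Proof.
  intros Hx.
  assert (Ha := Cmod_ge_0 al). assert (Hs := Rabs_pos s).
  set (B := (Cmod al * (Rabs s / x) * exp (Cmod al * (Rabs s + PI)))%R).
  set (f := fun u : R => Cexp (- (al * (Clog_right (x + u * (s * Ci)) - Clog_right x)))).
  assert (Eu : forall u : R, x + u * (s * Ci) = x + (u * s)%R * Ci)
    by (intros u; rewrite RtoC_mult; ring).
  assert (H : (Cmod (f 1%R - f 0%R) <= 2 * B * Rabs (1 - 0))%R).
  { apply mean_value_ineq with
      (fun u : R => - (al * ((s * Ci) / (x + u * (s * Ci)))) * f u).
    - intros u _. unfold f. eapply path_derive_eq.
      + apply path_derive_Cexp. apply path_derive_opp. apply path_derive_scal.
        apply path_derive_minus; [|apply path_derive_const].
        apply path_derive_Clog_right. apply path_derive_line. rewrite Eu, Re_vertical.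
        simpl; lra.
      + cbv beta. f_equal. ring.
    - rewrite Rmin_left, Rmax_right by lra. intros u Hu.
      assert (Hre : (x <= Cmod (x + (u * s)%R * Ci))%R).
      { apply Rle_trans with (2 := re_le_Cmod _). rewrite Re_vertical. apply Rle_abs. }
      unfold f. rewrite Eu. rewrite Cmod_mult, Cmod_opp, Cmod_mult.
      rewrite Cmod_div by (apply Re_pos_neq_0; rewrite Re_vertical; simpl; lra).
      rewrite Cmod_mult, Cmod_R, Cmod_Ci, Rmult_1_r.
      unfold B. apply Rmult_le_compat.
      + apply Rmult_le_pos; trivial. apply Rdiv_le_0_compat; lra.
      + apply Cmod_ge_0.
      + apply Rmult_le_compat_l; trivial. apply Rmult_le_compat_l; trivial.
        apply Rinv_le_contravar; lra.
      + apply Rle_trans with (1 := power_ratio_bound al x (u * s) Hx). apply exp_le.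
        apply Rmult_le_compat_l; trivial. rewrite Rabs_mult, (Rabs_right u) by lra. nra. }
  rewrite Rminus_0_r, Rabs_R1, Rmult_1_r in H.
  replace (Cexp (- (al * (Clog_right (x + s * Ci) - Clog_right x)))) with (f 1%R)
    by (unfold f; rewrite Eu, Rmult_1_l; reflexivity).
  replace (f 0%R) with (RtoC 1) in H.
  2: { unfold f. rewrite Eu, Rmult_0_l. replace (x + 0%R * Ci) with (RtoC x) by ring.
       rewrite <- Cexp_0. f_equal. ring. }
  apply Rle_trans with (1 := H).
  replace (Cmod al * PI + (Cmod al + 1) * Rabs s)%R with
    (Rabs s + Cmod al * (Rabs s + PI))%R by ring.
  rewrite exp_plus. unfold B.
  replace (2 * (Cmod al * (Rabs s / x) * exp (Cmod al * (Rabs s + PI))))%R with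
    (2 * Cmod al / x * (Rabs s * exp (Cmod al * (Rabs s + PI))))%R by (field; lra).
  apply Rmult_le_compat_l.
  - apply Rdiv_le_0_compat; lra.
  - apply Rmult_le_compat_r. left; apply exp_pos. generalize (exp_ineq1_le (Rabs s)). lra.
Qed.

(** Through p = x, the exponent t^2/2 - x t equals -x^2/2 - s^2/2 without a linear
    term, so that the normalized integrand is gauss s times the factor estimated in
    [power_ratio_near_1]. *)
Lemma line_integral_asymptotic al : exists D, forall x : R, (1 <= x)%R ->
  (Cmod (Cexp (al * Clog_right x + x * x / 2) * line_integral al x x - norm_const) <= D /
    x)%R.
Proof.
  set (D := (4 * exp (Cmod al * PI + (Cmod al + 1) ^ 2))%R).
  exists (PI * (2 * Cmod al * D))%R. intros x Hx.
  assert (Ha := Cmod_ge_0 al).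
  replace (PI * (2 * Cmod al * D) / x)%R with (PI * (2 * Cmod al / x * D))%R by (field;
    lra).
  assert (Hx0 : (0 < Re x)%R) by (simpl; lra).
  apply int_line_bound with
    (fun s : R => Cexp (al * Clog_right x + x * x / 2) * integrand al x (x + s * Ci) -
      gauss s).
  2: { apply int_line_minus. apply int_line_scal. now apply line_integral_correct.
  apply int_line_gauss. }
  intros s.
  replace (Cexp (al * Clog_right x + x * x / 2) * integrand al x (x + s * Ci) - gauss s)
    with
    (gauss s * (Cexp (- (al * (Clog_right (x + s * Ci) - Clog_right x))) - 1)).
  2: { assert (Em : Cexp (al * Clog_right x + x * x / 2) * integrand al x (x + s * Ci) =
         gauss s * Cexp (- (al * (Clog_right (x + s * Ci) - Clog_right x)))).
       { unfold integrand, gauss. rewrite <- Cexp_R, <- !Cexp_plus. f_equal.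
         rewrite RtoC_opp, RtoC_div, RtoC_pow by lra. rewrite vertical_sqr. field. }
       rewrite Em. ring. }
  rewrite Cmod_mult, Cmod_R, (Rabs_right (gauss s)) by (left; apply exp_pos).
  apply Rle_trans with (gauss s * (2 * Cmod al / x * exp (Cmod al * PI + (Cmod al + 1) *
    Rabs s)))%R.
  - apply Rmult_le_compat_l. left; apply exp_pos. now apply power_ratio_near_1.
  - unfold gauss.
    replace (2 * Cmod al / x * D / (1 + s ^ 2))%R with
      (2 * Cmod al / x * (D / (1 + s ^ 2)))%R
      by (field; split; nra).
    replace (exp (- (s ^ 2 / 2)) * (2 * Cmod al / x * exp (Cmod al * PI + (Cmod al + 1) *
      Rabs s)))%R
      with (2 * Cmod al / x * exp (Cmod al * PI + (Cmod al + 1) * Rabs s - s ^ 2 / 2))%R.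
    + apply Rmult_le_compat_l. apply Rdiv_le_0_compat; lra. apply exp_quadratic_le.
    + unfold Rminus. rewrite exp_plus. ring.
Qed.

Lemma pcU_integral_asymptotic al : recessive_asymptotic al (pcU_integral al).
Proof.
  intros eps Heps. destruct (line_integral_asymptotic al) as [D HD].
  assert (Hn := norm_const_pos).
  exists (Rmax 1 (Rabs D / (eps * sqrt (2 * PI)))). intros x Hx.
  assert (Hx1 : (1 < x)%R) by (apply Rle_lt_trans with (2 := Hx); apply Rmax_l).
  assert (Hx2 : (Rabs D / (eps * sqrt (2 * PI)) < x)%R) by (apply Rle_lt_trans with (2 :=
    Hx); apply Rmax_r).
  specialize (HD x ltac:(lra)).
  assert (EK : pcU_integral al x / recessive_model al x - 1 =
     (Cexp (al * Clog_right x + x * x / 2) * line_integral al x x - norm_const) /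
       norm_const).
  { unfold pcU_integral. rewrite (line_integral_path_independent al x 1 x) by (simpl; lra).
    assert (Em : Cexp (al * Clog_right x + x * x / 2) = Cexp (x * x / 4) / recessive_model
      al x).
    { unfold recessive_model. unfold Cdiv at 2. rewrite <- Cexp_opp, <- Cexp_plus. f_equal.
      field. }
    rewrite Em. field. split. apply recessive_model_neq_0. apply norm_const_neq_0. }
  rewrite EK, Cmod_div by apply norm_const_neq_0. unfold norm_const at 2.
  rewrite Cmod_R, (Rabs_right (sqrt _)) by lra.
  apply Rmult_lt_reg_r with (sqrt (2 * PI)); trivial.
  unfold Rdiv. rewrite Rmult_assoc, Rinv_l, Rmult_1_r by lra.
  apply Rle_lt_trans with (1 := HD).
  apply Rmult_lt_reg_r with x. lra.
  unfold Rdiv. rewrite Rmult_assoc, Rinv_l, Rmult_1_r by lra.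
  apply Rle_lt_trans with (1 := Rle_abs D).
  assert (Hes : (0 < eps * sqrt (2 * PI))%R) by now apply Rmult_lt_0_compat.
  replace (Rabs D) with (eps * sqrt (2 * PI) * (Rabs D / (eps * sqrt (2 * PI))))%R
    by (field; split; lra).
  now apply Rmult_lt_compat_l.
Qed.

(** * The function U as a recessive solution *)

Lemma pcU_is_solution a U : is_parabolic_cylinder_U a U -> exists U', solution a U U'.
Proof.
  intros [[U' [U'' H]] _]. exists U'. split; intros z d x.
  - apply path_derive_of_is_Cderive. apply H.
  - destruct (H (z + x * d)) as [_ [H2 H3]].
    replace (((z + x * d) * (z + x * d) / 4 + a) * U (z + x * d)) with (U'' (z + x * d)).
    + now apply path_derive_of_is_Cderive.
    + apply Ceq_minus in H3. rewrite H3. simpl. field.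
Qed.

(** The positive real axis lies in every sector around it. *)
Lemma pcU_recessive_asymptotic a U : is_parabolic_cylinder_U a U ->
  recessive_asymptotic (a + 1 / 2) U.
Proof.
  intros [_ H] eps Heps. assert (HP := PI_RGT_0).
  destruct (H (PI / 4)%R ltac:(lra) eps Heps) as [M HM].
  exists (Rmax M 0). intros x Hx.
  assert (Hx0 : (0 < x)%R) by (apply Rle_lt_trans with (2 := Hx); apply Rmax_r).
  assert (HxM : (M < x)%R) by (apply Rle_lt_trans with (2 := Hx); apply Rmax_l).
  assert (EL := Clog_eq_right x Hx0).
  replace (recessive_model (a + 1 / 2) x) with
    (Cpower x (- a - 1 / 2) * Cexp (- (x ^ 2 / 4))).
  - apply HM. { rewrite Cmod_R, Rabs_right; lra. }
    assert (EC : Carg x = 0%R).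
    { change (Im (Clog x) = 0%R). rewrite EL, Clog_right_R by trivial. reflexivity. }
    rewrite EC, Rabs_R0. lra.
  - unfold Cpower, recessive_model. rewrite EL, <- Cexp_plus. f_equal. simpl. field.
Qed.

(** * The saddle point *)

Lemma Cexp_Clog (w : C) : w <> 0 -> Cexp (Clog w) = w.
Proof.
  intros H. assert (Hm : (0 < Cmod w)%R) by now apply Cmod_gt_0.
  assert (Hre := re_le_Cmod w). apply Rabs_le_between in Hre.
  assert (Hb : (-1 <= Re w / Cmod w <= 1)%R).
  { split; apply Rmult_le_reg_r with (Cmod w); trivial;
    unfold Rdiv; rewrite Rmult_assoc, Rinv_l; lra. }
  assert (Hs : sqrt (1 - (Re w / Cmod w)²) = (Rabs (Im w) / Cmod w)%R).
  { replace (1 - (Re w / Cmod w)²)%R with ((Rabs (Im w) / Cmod w)²).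
    - apply sqrt_Rsqr. apply Rdiv_le_0_compat; trivial. apply Rabs_pos.
    - rewrite !Rsqr_div', <- Rsqr_abs. unfold Rsqr.
      replace (Im w * Im w)%R with (Cmod w * Cmod w - Re w * Re w)%R
        by (rewrite Cmod_sqr; ring).
      field. lra. }
  assert (Hc : cos (Carg w) = (Re w / Cmod w)%R /\ sin (Carg w) = (Im w / Cmod w)%R).
  { unfold Carg. destruct Rle_dec as [Hi|Hi].
    - rewrite cos_acos, sin_acos, Hs, Rabs_right by lra. tauto.
    - rewrite cos_neg, sin_neg, cos_acos, sin_acos, Hs, Rabs_left by lra.
      split; trivial. field. lra. }
  destruct Hc as [Hc1 Hc2].
  apply Ceq_parts; partsr; simpl; rewrite ?Hc1, ?Hc2, exp_ln by trivial; field; lra.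
Qed.

Lemma Csqrt_polar (w : C) : w <> 0 -> Csqrt w = Cexp (Clog w / 2).
Proof.
  intros H. assert (Hm : (0 < Cmod w)%R) by now apply Cmod_gt_0.
  replace (Clog w / 2) with (RtoC (ln (Cmod w) / 2) + Ci * (Carg w / 2)).
  - rewrite Cexp_plus, Cexp_R. unfold Csqrt. do 2 f_equal.
    rewrite <- Rpower_sqrt by trivial. unfold Rpower. f_equal. field.
  - rewrite RtoC_div by lra.
    replace (Clog w) with (RtoC (ln (Cmod w)) + Ci * Carg w)
      by (apply Ceq_parts; partsr; simpl; ring).
    field.
Qed.

Lemma Csqrt_sqr (w : C) : Csqrt w * Csqrt w = w.
Proof.
  destruct (Ceq_dec w 0) as [->|H].
  - unfold Csqrt. rewrite Cmod_0, sqrt_0. ring.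
  - rewrite Csqrt_polar, <- Cexp_plus by trivial.
    rewrite <- (Cexp_Clog w) at 3 by trivial. f_equal. field.
Qed.

Lemma Carg_bound w : (- PI <= Carg w <= PI)%R.
Proof.
  unfold Carg. generalize (acos_bound (Re w / Cmod w)) PI_RGT_0.
  destruct Rle_dec; lra.
Qed.

Lemma Re_Csqrt_ge_0 w : (0 <= Re (Csqrt w))%R.
Proof.
  unfold Csqrt. rewrite Re_mult, Re_R, Im_R, Rmult_0_l, Rminus_0_r.
  apply Rmult_le_pos. apply sqrt_pos.
  unfold Cexp, Re at 1; simpl fst. 
  apply Rmult_le_pos. left; apply exp_pos.
  replace (Im (Ci * (Carg w / 2))) with (Carg w / 2)%R.
  - generalize (Carg_bound w). intros. apply cos_ge_0; lra.
  - rewrite <- RtoC_div by lra. partsr. ring.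
Qed.

Lemma saddle_equation alpha z :
  let t0 := saddle_point alpha z in t0 * t0 - z * t0 = alpha.
Proof.
  intros t0. unfold t0, saddle_point.
  assert (H := Csqrt_sqr (z ^ 2 + 4 * alpha)). revert H.
  generalize (Csqrt (z ^ 2 + 4 * alpha)). intros w H.
  replace ((z + w) / 2 * ((z + w) / 2) - z * ((z + w) / 2)) with ((w * w - z * z) / 4) by
    field.
  rewrite H. simpl. field.
Qed.

(** A square root on the imaginary axis has a real square that is at most 0, and
    z^2 + 4 al is of this kind exactly on the cuts. *)
Lemma Re_Csqrt_off_cut (al : R) z : (0 < al)%R -> ~ on_cut al z ->
  (0 < Re (Csqrt (z ^ 2 + 4 * al)))%R.
Proof.
  intros Hal Hcut.
  destruct (Re_Csqrt_ge_0 (z ^ 2 + 4 * al)) as [H|H]; trivial. exfalso. apply Hcut.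
  assert (Hs := Csqrt_sqr (z ^ 2 + 4 * al)). revert H Hs.
  generalize (Csqrt (z ^ 2 + 4 * al)). intros w H Hs.
  assert (H1 : Re (w * w) = Re (z * z + 4 * al)) by (rewrite Hs; f_equal; simpl; ring).
  assert (H2 : Im (w * w) = Im (z * z + 4 * al)) by (rewrite Hs; f_equal; simpl; ring).
  revert H1 H2. partsr. rewrite <- H. intros H1 H2.
  assert (Hz : (Re z * Im z = 0)%R) by lra.
  assert (Hx : Re z = 0%R).
  { apply Rmult_integral in Hz. destruct Hz as [Hz|Hz]; trivial. rewrite Hz in H1. nra. }
  split; trivial. rewrite Hx in H1.
  apply Rsqr_incr_0_var; [|apply Rabs_pos].
  rewrite <- Rsqr_abs. unfold Rsqr.
  replace (2 * sqrt al * (2 * sqrt al))%R with (4 * (sqrt al * sqrt al))%R by ring.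
  rewrite sqrt_sqrt by lra. nra.
Qed.

(** For Re z > 0 it suffices that the square root has nonnegative real part. For
    alpha > 0, off the cuts, the two roots have product - alpha and the saddle point is
    the one with the larger real part, which is therefore positive. *)
Lemma Re_saddle_point_pos alpha z :
  (0 < Re z)%R \/ (Im alpha = 0%R /\ (0 < Re alpha)%R /\ ~ on_cut (Re alpha) z) ->
  (0 < Re (saddle_point alpha z))%R.
Proof.
  intros [H|[Ia [Ra Hcut]]].
  - unfold saddle_point. rewrite Re_half, Re_plus.
    generalize (Re_Csqrt_ge_0 (z ^ 2 + 4 * alpha)). lra.
  - assert (Ea : alpha = RtoC (Re alpha)) by (apply Ceq_parts; simpl; trivial).
    assert (Hw := Re_Csqrt_off_cut (Re alpha) z Ra Hcut). rewrite <- Ea in Hw.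
    assert (Hs := saddle_equation alpha z). cbv zeta in Hs.
    assert (Hd : (0 < 2 * Re (saddle_point alpha z) - Re z)%R).
    { unfold saddle_point. rewrite Re_half, Re_plus. lra. }
    revert Hs Hd. generalize (saddle_point alpha z). intros t Hs Hd.
    (* With t' the other root, t t' = - alpha < 0 forces the real parts of t and
       t' to have opposite signs, and Re t' < Re t. *)
    set (t' := z - t).
    assert (Hp : t * t' = - alpha) by (rewrite <- Hs; unfold t'; ring).
    assert (Hd' : (Re t' < Re t)%R) by (unfold t'; rewrite Re_minus; lra).
    assert (H1 : Re (t * t') = (- Re alpha)%R) by (rewrite Hp; reflexivity).
    assert (H2 : Im (t * t') = 0%R) by (rewrite Hp, Im_opp, Ia; ring).
    revert H1 H2. partsr. intros H1 H2.
    destruct (Rlt_le_dec 0 (Re t)) as [H|H]; trivial. exfalso.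
    assert (E : (Re t' * (Re t * Re t + Im t * Im t) = - Re alpha * Re t)%R).
    { rewrite <- H1. generalize (f_equal (Rmult (Im t)) H2). lra. }
    assert (Hn : (0 <= Re t * Re t + Im t * Im t)%R) by nra.
    destruct Hn as [Hn|Hn]. nra.
    assert (Re t = 0%R) by nra. assert (Im t = 0%R) by nra. nra.
Qed.

(** * The integral representation *)

Theorem lemma2p1 :
  forall (a : C) (U : C -> C) (z : C),
  is_parabolic_cylinder_U a U ->
  let alpha := a + 1 / 2 in
  let t0 := saddle_point alpha z in
  (0 < Re z)%R \/
  (Im alpha = 0%R /\ (0 < Re alpha)%R /\ ~ on_cut (Re alpha) z) ->
  exists J : C,
    @is_RInt_gen C_R_NormedModule
      (fun s : R => Cexp (- (s ^ 2 / 2) + Ci * alpha * saddle_f (s / t0)))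
      (Rbar_locally m_infty) (Rbar_locally p_infty) J /\
    U z = 1 / sqrt (2 * PI)
          * Cexp (- (z * Csqrt (z ^ 2 + 4 * alpha) / 4))
          * Cexp (alpha / 2) * Cpower t0 (- alpha) * J.
Proof.
  intros a U z HU alpha t0 Hcase.
  assert (Hp : (0 < Re t0)%R) by now apply Re_saddle_point_pos.
  assert (Hs : t0 * t0 - z * t0 = alpha) by apply saddle_equation.
  assert (Hn := Re_pos_neq_0 t0 Hp).
  set (c := Cexp (- (t0 * t0 / 2 - z * t0 - alpha * Clog_right t0))).
  (* c removes the value at t0 of the exponent of the integrand. *)
  exists (c * line_integral alpha z t0). split.
  - apply (int_line_ext (fun s => c * integrand alpha z (t0 + s * Ci))).
    2: now apply int_line_scal, line_integral_correct.
    intros s. unfold c, integrand, saddle_f. rewrite <- Cexp_plus. f_equal.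
    replace (1 + Ci * (s / t0)) with ((t0 + s * Ci) / t0) by (field; trivial).
    rewrite Clog_quotient, vertical_sqr by (trivial; now rewrite Re_vertical).
    set (l := Clog_right (t0 + s * Ci)). set (l0 := Clog_right t0).
    replace (Ci * alpha * (s / t0 + Ci * (l - l0))) with
      (Ci * s * (alpha / t0) + (Ci * Ci) * alpha * (l - l0)) by (field; trivial).
    replace (Ci * Ci) with (- (1)) by (apply Ceq_parts; partsr; ring).
    (* The saddle point equation turns i s (t0 - z) into the term i alpha s / t0. *)
    replace (alpha / t0) with (t0 - z) by (rewrite <- Hs; field; trivial).
    field.
  - destruct (pcU_is_solution a U HU) as [U' SU].
    assert (SV := pcU_integral_solution alpha).
    replace (alpha - 1 / 2) with a in SV by (unfold alpha; ring).
    rewrite (recessive_unique a alpha U U' (pcU_integral alpha) (pcU_integral' alpha) SU SV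
      (pcU_recessive_asymptotic a U HU) (pcU_integral_asymptotic alpha) z).
    unfold pcU_integral, norm_const.
    rewrite (line_integral_path_independent alpha z 1 t0) by (trivial; simpl; lra).
    unfold Cpower. rewrite (Clog_eq_right t0 Hp).
    assert (Ew : Csqrt (z ^ 2 + 4 * alpha) = 2 * t0 - z).
    { unfold t0, saddle_point. field. }
    rewrite Ew.
    replace (Cexp (z * z / 4)) with
      (Cexp (- (z * (2 * t0 - z) / 4)) * Cexp (alpha / 2) * Cexp (- alpha * Clog_right t0)
        * c).
    + unfold Cdiv. ring.
    + unfold c. rewrite <- !Cexp_plus. f_equal. generalize (Clog_right t0). intros l.
      rewrite <- Hs. field.
Qed.
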